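(* Let $q$ be a prime power and let $D_n$ be the number of monic polynomials of degree $n$ over the finite field $\mathbb{F}_q$ all of whose irreducible factors have distinct degrees. The probability $D_n/q^n$ that a uniformly random monic polynomial of degree $n$ over $\mathbb{F}_q$ has all its irreducible factors of distinct degrees satisfies, as $n\to\infty$, the asymptotic estimate $$\frac{D_n}{q^n}=\delta(q)+O\left(\frac1n\right),$$ where the constant $\delta(q)$ is given by $$\delta(q)=\prod_{k\ge1}\left(1+\frac{I_k}{q^k}\right)\left(1-q^{-k}\right)^{I_k},$$ with $I_k$ the number of monic irreducible polynomials of degree $k$ over $\mathbb{F}_q$. In addition, this probability admits a full asymptotic expansion with oscillating coefficients.
   Context: Irreducible factors are counted with multiplicity, so the condition means that for each degree $k$ the polynomial has at most one (monic) irreducible factor of degree $k$, and it occurs with multiplicity one; equivalently, $\sum_{n\ge0}D_nz^n=\prod_{n=1}^\infty(1+I_nz^n)$. A sequence $(f_n)$ is said to admit a full asymptotic expansion with oscillating coefficients if it is of the form $f_n\sim\sum_{r\ge0}\frac{P_r(n)}{n^{\alpha_r}}$ ($n\to\infty$), where the exponents $\alpha_r$ increase to $+\infty$ and each $P_r(n)$ is a polynomial in $\log n$ whose coefficients are periodic functions of $n$. *)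

(* Defs.v *)
From mathcomp Require Import all_boot all_order all_algebra.
From mathcomp Require Import all_classical all_reals all_analysis.
Import Order.TTheory GRing.Theory Num.Theory.
Import numFieldNormedType.Exports.

Set Implicit Arguments.
Unset Strict Implicit.
Unset Printing Implicit Defensive.

Local Open Scope classical_set_scope.
Local Open Scope ring_scope.

(* Irreducible factors are counted with multiplicity: a repeated factor
   already violates distinctness of the degrees. *)
Definition distinct_degree_factors (F : fieldType) (p : {poly F}) : Prop :=
  (forall g h : {poly F},
     g \is monic -> irreducible_poly g -> g %| p ->
     h \is monic -> irreducible_poly h -> h %| p ->
     size g = size h -> g = h) /\
  (forall g : {poly F},
     g \is monic -> irreducible_poly g -> ~~ (g ^+ 2 %| p)).

(* Since size is degree + 1, the monic polynomials of degree n are the elements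
   of size exactly n.+1 in the finite type of polynomials of size <= n.+1. *)
Definition num_monic (F : finFieldType) (P : {poly F} -> Prop) (n : nat) : nat :=
  #|[pred p : {poly_(n.+1) F} |
      [&& val p \is monic, size (val p) == n.+1 & `[< P (val p) >]]]|.

Definition num_distinct_degree (F : finFieldType) (n : nat) : nat :=
  num_monic (@distinct_degree_factors F) n.

Definition num_irreducible (F : finFieldType) (k : nat) : nat :=
  num_monic (@irreducible_poly F) k.

Definition delta_partial (R : realType) (F : finFieldType) (n : nat) : R :=
  \prod_(1 <= k < n.+1)
     ((1 + (num_irreducible F k)%:R / #|F|%:R ^+ k)
      * (1 - #|F|%:R ^- k) ^+ num_irreducible F k).

Definition delta (R : realType) (F : finFieldType) : R :=
  limn (delta_partial R F).

Definition periodic_seq (T : Type) (c : nat -> T) : Prop :=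
  exists2 t : nat, (0 < t)%N & forall n, c (n + t)%N = c n.

Definition oscillating_log_poly (R : realType) (P : nat -> R) : Prop :=
  exists (d : nat) (c : nat -> nat -> R),
    (forall j, periodic_seq (c j)) /\
    (forall n, P n = \sum_(j < d) c j n * ln n%:R ^+ j).

(* The expansion f n ~ sum_r P r n / n ^ alpha r is meant in the sense of
   Poincare: truncating after the term of index m leaves an error
   o(n ^ (- alpha m)). As this is required for every m and alpha is strictly
   increasing, it is equivalent to the error having the order (up to powers of
   log n) of the first omitted term. *)
Definition full_oscillating_expansion (R : realType) (f : nat -> R) : Prop :=
  exists (alpha : nat -> R) (P : nat -> nat -> R),
    [/\ {homo alpha : r s / (r < s)%N >-> r < s},
        alpha @ \oo --> +oo,
        (forall r, oscillating_log_poly (P r)) &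
        forall m : nat,
          (fun n : nat => f n - \sum_(r < m.+1) P r n / n%:R `^ alpha r)
          =o_\oo (fun n : nat => n%:R `^ (- alpha m))].

(* Main.v *)
Require Import Defs.
From mathcomp Require Import all_boot all_order all_algebra.
From mathcomp Require Import all_classical all_reals all_analysis.
From mathcomp Require Import zify ring lra.
Import Order.TTheory GRing.Theory Num.Theory.
Import numFieldNormedType.Exports.
Set Implicit Arguments.
Unset Strict Implicit.
Unset Printing Implicit Defensive.
Local Open Scope classical_set_scope.
Local Open Scope ring_scope.

(** With [a_k = I_k / q^k], unique factorization makes [prob n] the coefficient of
    [z^n] in [prod_k (1 + a_k z^k)], and [prod_k (1 - (z / q)^k)^(I_k) = 1 - z].  Hence
    [(1 - z) sum_n (prob n) z^n = (1 + a_1 z) H(z)] where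
    [H(z) = (1 - z / q)^(I_1) prod_(k >= 2) (1 + a_k z^k) (1 - (z / q)^k)^(I_k)].
    Since [k a_k = 1 + O(q^(-k/2))], the coefficients [c_n] of [z H' / H] are, for
    every [s], combinations of [p_r(n) / n^r] with [p_r] periodic and [1 <= r <= s], up to
    [O(n^(-s-1))].  The recurrence [n h_n = sum_k c_k h_(n-k)] then bounds the
    coefficients of [H], and of its finite subproducts uniformly, by [O(n^(-2))]; this
    yields the limit [delta] and the error term [O(1/n)].

    For the full expansion no complex analysis is needed.  Consider the convolutions
    [y = x_1 * ... * x_m * e * h], each [x_i] of the form [p(n) / n^r] with [r >= 1] and
    [e] rapidly decreasing.  By Leibniz' rule and the recurrence, [n y_n] is a sum of
    sequences of the same kind and of convolutions of such sequences (with fewer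
    factors) with periodic sequences.  The latter are partial sums, whose expansions
    come from summation by parts, so each division by [n] gains one order. *)

(** * Counting monic polynomials *)

(** Origin of the estimates: counting the total degree of all monic polynomials of degree [n] in two
    ways gives Gauss's formula [sum_(d | n) d I_d = q^n]; proper divisors being at most [n / 2], it
    makes [k a_k] exponentially close to 1. The [n]-th coefficient of [z H' / H] is a sum over the
    divisors [k] of [n]. For [n >= 2] the term [k = n] cancels thanks to the factors
    [(1 - (z / q)^k)^(I_k)], and a divisor with [n / k = r + 1] fixed contributes about
    [(- 1 / k)^r], a constant over [n^r] present only when [r + 1] divides [n]. This is the source
    of the oscillation. Three obstacles shape the rest. The constant is a limit of finite products
    at [z = 1], so exchanging limits requires bounds uniform in the truncation. Convolving terms of
    order [1 / n] creates powers of [ln n]; error terms therefore carry a spare half power of [n]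
    that absorbs them. Finally, expansions to different orders are obtained independently, and
    gluing them needs uniqueness of the coefficients. *)

Definition monics (F : finFieldType) (P : {poly F} -> Prop) (n : nat) : seq {poly F} :=
  [seq val p | p : {poly_(n.+1) F} in
     [pred p : {poly_(n.+1) F} |
      [&& val p \is monic, size (val p) == n.+1 & `[< P (val p) >]]]].

(** Counts are compared through duplicate-free lists of plain polynomials, because the types
    [{poly_(n.+1) F}] for different [n] are unrelated. *)
Lemma size_monics (F : finFieldType) (P : {poly F} -> Prop) n :
  size (monics P n) = num_monic P n.
Proof. by rewrite size_map -cardE. Qed.

Lemma monics_uniq (F : finFieldType) (P : {poly F} -> Prop) n : uniq (monics P n).
Proof. by rewrite map_inj_uniq ?enum_uniq //; apply: val_inj. Qed.

Lemma monicsP (F : finFieldType) (P : {poly F} -> Prop) n p :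
  reflect [/\ p \is monic, size p = n.+1 & P p] (p \in monics P n).
Proof.
apply: (iffP fintype.imageP) => [[x]|[pm ps pP]].
  by rewrite inE => /and3P[xm /eqP xs /asboolP xP] ->.
have hp : (size p <= n.+1)%N by rewrite ps.
exists (npolyp n.+1 p); rewrite ?inE /= npolypK //.
by rewrite pm ps eqxx; apply/asboolP.
Qed.

Lemma num_monic_true (F : finFieldType) n :
  num_monic (fun _ : {poly F} => True) n = (#|F| ^ n)%N.
Proof.
have u : uniq [seq 'X^n + val p | p : {poly_n F}].
  by rewrite map_inj_uniq ?enum_uniq // => x y /addrI /val_inj.
rewrite -(card_npoly F) cardE -(size_map (fun p : {poly_n F} => 'X^n + val p)).
rewrite -size_monics; apply/perm_size/uniq_perm; rewrite ?monics_uniq //.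
move=> p; apply/monicsP/mapP => [[pm ps _]|[x _ ->]].
  have hs : (size (p - 'X^n)%R <= n)%N.
    apply/leq_sizeP => j; rewrite leq_eqVlt coefB coefXn => /orP[/eqP<-|nj].
      by rewrite eqxx; move/monicP: pm; rewrite /lead_coef ps /= => ->; rewrite subrr.
    by rewrite nth_default ?ps // gtn_eqF // subrr.
  exists (npolyp n (p - 'X^n)); first by rewrite mem_enum.
  by rewrite /= npolypK // addrC subrK.
have hs : (size (val x) < size ('X^n : {poly F}))%N.
  by rewrite size_polyXn ltnS size_npoly.
split=> //; last by rewrite size_polyDl // size_polyXn.
by rewrite monicE lead_coefDl // lead_coefXn.
Qed.

Lemma irreducible_factor (F : fieldType) (p : {poly F}) :
  p \is monic -> (1 < size p)%N ->
  exists g : {poly F}, [/\ g \is monic, irreducible_poly g & g %| p].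
Proof.
have [n] := ubnP (size p); elim: n p => // n IHn p psn pm p1.
have [pi|npi] := pselect (irreducible_poly p).
  by exists p; split.
have [d [d1 dp dnp]] : exists d : {poly F}, [/\ size d != 1%N, d %| p & ~~ (d %= p)].
  apply: contrapT => H; apply: npi; split=> // d d1 dp.
  by apply/negPn/negP => nd; apply: H; exists d.
have p0 : p != 0 by rewrite monic_neq0.
have d0 : d != 0 by apply: contraNneq p0 => d0; move: dp; rewrite d0 dvd0p.
have sd : (0 < size d)%N by rewrite size_poly_gt0.
have ld : lead_coef d != 0 by rewrite lead_coef_eq0.
have ld' : (lead_coef d)^-1 != 0 by rewrite invr_eq0.
have [|||g [gm gi gd]] := IHn ((lead_coef d)^-1 *: d).
- rewrite size_scale //; apply: leq_trans (_ : size p <= n)%N; last by [].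
  rewrite ltn_neqAle dvdp_leq // andbT.
  by apply: contra dnp => sdp; rewrite -dvdp_size_eqp.
- by rewrite monicE lead_coefZ mulVf.
- by rewrite size_scale //; case: (size d) sd d1 => [|[]].
by exists g; split=> //; apply: dvdp_trans gd _; rewrite dvdpZl.
Qed.

Lemma monic_irreducible_dvd_eq (F : fieldType) (g h : {poly F}) :
  g \is monic -> irreducible_poly g -> h \is monic -> irreducible_poly h ->
  g %| h -> g = h.
Proof.
move=> gm gi hm hi gh; apply/eqP; rewrite -eqp_monic //.
by case: hi => _; apply => //; case: gi; case: (size g) => [|[]].
Qed.

Lemma monic_irreducible_coprime (F : fieldType) (g h : {poly F}) :
  g \is monic -> irreducible_poly g -> h \is monic -> irreducible_poly h ->
  g != h -> coprimep g h.
Proof.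
move=> gm gi hm hi; apply: contraNT.
by rewrite irreducible_poly_coprime // negbK => /monic_irreducible_dvd_eq ->.
Qed.

Lemma monic_irreducible_dvdM (F : fieldType) (g p r : {poly F}) :
  irreducible_poly g -> g %| p * r -> (g %| p) || (g %| r).
Proof.
move=> gi gpr; have [//|ngp /=] := boolP (g %| p).
by rewrite -(Gauss_dvdpr r (_ : coprimep g p)) // irreducible_poly_coprime.
Qed.

(** The class counted by the factors of index at most [k] in [prod_k (1 + I_k z^k)], so that the
    product can be built one factor at a time. *)
Definition distinct_degree_upto (F : fieldType) (k : nat) (p : {poly F}) : Prop :=
  distinct_degree_factors p /\
  forall g : {poly F}, g \is monic -> irreducible_poly g -> g %| p -> (size g <= k.+1)%N.

Lemma irreducible_not_dvd1 (F : fieldType) (g : {poly F}) :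
  irreducible_poly g -> ~~ (g %| 1).
Proof. by case=> g1 _; apply/negP => /dvdp_leq; rewrite oner_eq0 size_poly1 leqNgt g1 => /(_ isT). Qed.

Lemma distinct_degree_upto_dvd (F : fieldType) k (p r : {poly F}) :
  p %| r -> distinct_degree_upto k r -> distinct_degree_upto k p.
Proof.
move=> pr [[d1 d2] d3]; split; last by move=> g gm gi gp; apply: d3 => //; apply: dvdp_trans pr.
split=> [g h gm gi gp hm hi hp|g gm gi].
  by apply: d1 => //; apply: dvdp_trans pr.
by apply: contra (d2 _ gm gi) => gp; apply: dvdp_trans pr.
Qed.

Lemma distinct_degree_uptoM (F : fieldType) k (g p : {poly F}) :
  g \is monic -> irreducible_poly g -> size g = k.+2 ->
  distinct_degree_upto k p -> distinct_degree_upto k.+1 (g * p).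
Proof.
move=> gm gi gs [[d1 d2] d3].
have fac h : h \is monic -> irreducible_poly h -> h %| g * p -> h = g \/ h %| p.
  move=> hm hi /(monic_irreducible_dvdM hi) /orP[|]; last by right.
  by left; apply: monic_irreducible_dvd_eq.
have ngp : ~~ (g %| p) by apply/negP => /(d3 _ gm gi); rewrite gs ltnn.
split; last first.
  by move=> h hm hi /(fac _ hm hi) [->|/(d3 _ hm hi)]; rewrite ?gs // => /leqW.
split=> [h1 h2 m1 i1 v1 m2 i2 v2 ss|h hm hi].
  case: (fac _ m1 i1 v1) (fac _ m2 i2 v2) => [e1|w1] [e2|w2].
  - by rewrite e1.
  - by have := d3 _ m2 i2 w2; rewrite -ss e1 gs ltnn.
  - by have := d3 _ m1 i1 w1; rewrite ss e2 gs ltnn.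
  - exact: d1.
have [->|hg] := eqVneq h g.
  by rewrite expr2 dvdp_mul2l // monic_neq0.
rewrite Gauss_dvdpr ?d2 // expr2 coprimepMl.
by rewrite monic_irreducible_coprime.
Qed.

Lemma num_distinct_degree_upto0 (F : finFieldType) n :
  num_monic (@distinct_degree_upto F 0) n = (n == 0)%N.
Proof.
rewrite -size_monics.
case: n => [|n] /=.
  apply: (perm_size (s2 := [:: 1])); apply: uniq_perm; rewrite ?monics_uniq // => p.
  rewrite inE; apply/monicsP/eqP => [[pm ps _]|->].
    by apply/eqP; rewrite -(eqp_monic pm (monic1 _)) -size_poly_eq1 ps.
  split; rewrite ?monic1 ?size_poly1 //; split; last first.
    by move=> g gm gi; rewrite (negbTE (irreducible_not_dvd1 gi)).
  split=> [g h gm gi|g gm gi]; first by rewrite (negbTE (irreducible_not_dvd1 gi)).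
  by apply: contra (irreducible_not_dvd1 gi); apply: dvdp_trans; rewrite expr2 dvdp_mulr.
case E: (monics _ _) => [//|p s].
have : p \in monics (@distinct_degree_upto F 0) n.+1 by rewrite E mem_head.
move=> /monicsP [pm ps [_ d3]].
have [|g [gm gi gp]] := irreducible_factor pm; first by rewrite ps.
by have := d3 g gm gi gp; case: gi; rewrite ltnNge => /negP.
Qed.

(** Multiplication by [1 + I_(k+1) z^(k+1)] on coefficients: either [f] has no irreducible factor of
    degree [k + 1], or it has exactly one, [g], and [f / g] only has factors of smaller degree. *)
Lemma num_distinct_degree_uptoS (F : finFieldType) k n :
  num_monic (@distinct_degree_upto F k.+1) n =
  (num_monic (@distinct_degree_upto F k) n +
   (k < n) * (num_irreducible F k.+1 *
              num_monic (@distinct_degree_upto F k) (n - k.+1)))%N.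
Proof.
rewrite /num_irreducible -!size_monics.
set A := monics _ _; set B := monics _ _; set I := monics _ _; set C := monics _ _.
pose D := if (k < n)%N then [seq g * p | g <- I, p <- C] else [::].
have -> : (size B + (k < n) * (size I * size C))%N = size (B ++ D).
  by rewrite size_cat /D; case: ltnP; rewrite ?size_allpairs ?mul1n.
have dvd_in g p : g \in I -> p \in C ->
    [/\ g \is monic, irreducible_poly g, size g = k.+2, p \is monic &
        distinct_degree_upto k p].
  by move=> /monicsP[? ? ?] /monicsP[? ? ?].
have ngp g p : g \in I -> p \in C -> ~~ (g %| p).
  move=> gI pC; have [gm gi gs pm [_ d3]] := dvd_in _ _ gI pC.
  by apply/negP => /(d3 _ gm gi); rewrite gs ltnn.
apply/perm_size/uniq_perm; rewrite ?monics_uniq //.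
  rewrite cat_uniq monics_uniq /=; apply/andP; split.
    rewrite /D; case: ifP => // kn; apply/hasPn => _ /allpairsP[[g p] [/= gI pC ->]].
    apply/negP => /monicsP[_ _ [_ d3]].
    have [gm gi gs pm _] := dvd_in _ _ gI pC.
    by have := d3 _ gm gi (dvdp_mulr _ (dvdpp g)); rewrite gs ltnn.
  rewrite /D; case: ifP => // kn; apply: allpairs_uniq; rewrite ?monics_uniq //.
  move=> [g p] [g' p'] /allpairsP[[u v] [/= uI vC [-> ->]]].
  move=> /allpairsP[[u' v'] [/= uI' vC' [-> ->]]] /= e.
  have [gm gi gs _ _] := dvd_in _ _ uI vC; have [gm' gi' gs' _ _] := dvd_in _ _ uI' vC'.
  have gg : u = u'.
    have : u %| u' * v' by rewrite -e dvdp_mulr.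
    move=> /(monic_irreducible_dvdM gi) /orP[|uv]; first exact: monic_irreducible_dvd_eq.
    case: (dvd_in _ _ uI' vC') => _ _ _ _ [_ d3].
    by have := d3 _ gm gi uv; rewrite gs ltnn.
  by move: e; rewrite -gg => /(mulfI (monic_neq0 gm)) ->.
move=> f; rewrite mem_cat; apply/idP/orP => [/monicsP[fm fs fd]|[|]].
- have [[g [gm gi gs gf]]|none] := pselect (exists g : {poly F},
    [/\ g \is monic, irreducible_poly g, size g = k.+2 & g %| f]); last first.
    left; apply/monicsP; split=> //; case: fd => d d3; split=> // g gm gi gf.
    have := d3 g gm gi gf; rewrite leq_eqVlt => /orP[/eqP gs|//].
    by case: none; exists g.
  right; have := dvdp_leq (monic_neq0 fm) gf; rewrite gs fs ltnS => kn.
  rewrite /D kn; apply/allpairsP; exists (g, f %/ g) => /=.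
  have e : f = g * (f %/ g) by rewrite mulrC divpK.
  have pm : f %/ g \is monic.
    by move: fm; rewrite {1}e monicMl.
  split=> //; apply/monicsP; split=> //.
    by rewrite size_divp ?monic_neq0 // fs gs /= subSn.
  have := distinct_degree_upto_dvd (_ : f %/ g %| f) fd.
  rewrite {2}e dvdp_mull // => /(_ isT) [d d3]; split=> // h hm hi hp.
  have := d3 h hm hi hp; rewrite leq_eqVlt => /orP[/eqP hs|//].
  (* A factor [h] of [f / g] of the top degree would equal [g], and [g ^+ 2] would divide [f]. *)
  case: fd => -[d1 d2] _.
  have hg : h = g.
    by apply: d1; rewrite ?hs ?gs //; apply: dvdp_trans hp _; rewrite [X in _ %| X]e dvdp_mull.
  case/negP: (d2 g gm gi); rewrite [X in _ %| X]e expr2 dvdp_mul2l ?monic_neq0 //.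
  by rewrite -{1}hg.
- move=> /monicsP[fm fs [d d3]]; apply/monicsP; split=> //; split=> // g gm gi gf.
  exact/leqW/d3.
- rewrite /D; case: ifP => // kn /allpairsP[[g p] [/= gI pC ->]].
  have [gm gi gs pm pd] := dvd_in _ _ gI pC; apply/monicsP; split.
  + by rewrite monicMl.
  + have /monicsP[_ ps _] := pC.
    by rewrite size_monicM ?monic_neq0 // gs ps; lia.
  + exact: distinct_degree_uptoM.
Qed.

Lemma num_distinct_degreeE (F : finFieldType) n :
  num_distinct_degree F n = num_monic (@distinct_degree_upto F n) n.
Proof.
rewrite /num_distinct_degree -!size_monics; apply/perm_size/uniq_perm; rewrite ?monics_uniq //.
move=> p; apply/monicsP/monicsP => -[pm ps]; last by case.
by move=> pd; split=> //; split=> // g gm gi /(dvdp_leq (monic_neq0 pm)); rewrite ps.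
Qed.

(** * Gauss's formula for the number of irreducible polynomials *)

Lemma size_exp_monic (F : fieldType) (g : {poly F}) j :
  g \is monic -> size (g ^+ j) = ((size g).-1 * j).+1.
Proof.
by move=> gm; rewrite -size_exp prednK // size_poly_gt0 expf_neq0 // monic_neq0.
Qed.

Lemma count_dvd_monics (F : finFieldType) (g : {poly F}) d n :
  g \is monic -> size g = d.+1 ->
  (\sum_(f <- monics (fun _ : {poly F} => True) n) (g %| f)%R =
   (d <= n) * #|F| ^ (n - d))%N.
Proof.
move=> gm gs; rewrite -big_mkcond /= sum1_count -size_filter.
have [dn|nd] := leqP d n; last first.
  rewrite mul0n; case E: (seq.filter _ _) => [//|f s].
  have : f \in seq.filter (dvdp g) (monics (fun _ : {poly F} => True) n) by rewrite E mem_head.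
  rewrite mem_filter => /andP[gf /monicsP[fm fs _]].
  by have := dvdp_leq (monic_neq0 fm) gf; rewrite gs fs ltnS leqNgt nd.
rewrite mul1n -num_monic_true -size_monics -[RHS](size_map (fun p => g * p)).
apply/perm_size/uniq_perm; rewrite ?filter_uniq ?monics_uniq //.
  by rewrite map_inj_uniq ?monics_uniq // => u v /(mulfI (monic_neq0 gm)).
move=> f; rewrite mem_filter; apply/andP/mapP => [[gf /monicsP[fm fs _]]|[p /monicsP[pm ps _] ->]].
  have e : f = g * (f %/ g) by rewrite mulrC divpK.
  exists (f %/ g) => //; apply/monicsP; split=> //.
    by move: fm; rewrite {1}e monicMl.
  by rewrite size_divp ?monic_neq0 // fs gs /= subSn.
split; first exact: dvdp_mulr.
apply/monicsP; split; rewrite ?monicMl // size_monicM ?monic_neq0 // gs ps; lia.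
Qed.

(** The multiplicity of a nonconstant [g] in [f] when [f] has degree at most [n]; as a sum of
    divisibility indicators it can be summed over [f] first. *)
Definition irr_mult (F : finFieldType) n (g f : {poly F}) : nat :=
  (\sum_(1 <= j < n.+1) (g ^+ j %| f)%R)%N.

Lemma irr_multM (F : finFieldType) n (g h f : {poly F}) :
  g \is monic -> irreducible_poly g -> h \is monic -> irreducible_poly h ->
  f \is monic -> (size f <= n)%N ->
  irr_mult n g (h * f)%R = (irr_mult n g f + (g == h))%N.
Proof.
move=> gm gi hm hi fm fn; rewrite /irr_mult.
have [<-|gh] := eqVneq g h; last first.
  rewrite addn0; apply: eq_bigr => j _; congr (nat_of_bool _).
  by rewrite Gauss_dvdpr // coprimep_expl // monic_irreducible_coprime.
case: n fn => [|n] fn.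
  by move: fn; rewrite leqn0 size_poly_eq0 (negbTE (monic_neq0 fm)).
rewrite big_nat_recl // [in RHS]big_nat_recr //= expr1 dvdp_mulr // addnAC.
have -> : (g ^+ n.+1 %| f) = false.
  apply/negP => /(dvdp_leq (monic_neq0 fm)).
  rewrite size_exp_monic //; case: gi => g1 _.
  by move=> /leq_trans /(_ fn); rewrite ltnNge leq_pmull // -ltnS prednK // ltnW.
rewrite addn0 addnC; congr addn; apply: eq_bigr => j _.
by rewrite exprS dvdp_mul2l ?monic_neq0.
Qed.

Lemma sum_irr_degree (F : finFieldType) n (f : {poly F}) :
  f \is monic -> (size f <= n.+1)%N ->
  (\sum_(1 <= d < n.+1) \sum_(g <- monics (@irreducible_poly F) d) d * irr_mult n g f =
   (size f).-1)%N.
Proof.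
have [k] := ubnP (size f); elim: k f => // k IHk f fk fm fn.
have [f1|f1] := leqP (size f) 1.
  have fe : f = 1.
    apply/eqP; rewrite -(eqp_monic fm (monic1 _)) -size_poly_eq1.
    by rewrite eqn_leq f1 size_poly_gt0 monic_neq0.
  rewrite fe size_poly1 /=; apply: big1 => d _; rewrite big_seq; apply: big1 => g /monicsP[gm _ gi].
  rewrite /irr_mult big_nat big1 ?muln0 // => j /andP[j1 _].
  apply/eqP; rewrite eqb0; apply: contra (irreducible_not_dvd1 gi).
  by apply: dvdp_trans; rewrite -{1}(expr1 g) dvdp_exp2l.
have [h [hm hi hf]] := irreducible_factor fm f1.
have e : f = h * (f %/ h) by rewrite mulrC divpK.
set p := f %/ h in e.
have pm : p \is monic by move: fm; rewrite e monicMl.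
have h1 : (1 < size h)%N by case: hi.
have sf : size f = (size h + size p).-1 by rewrite e size_monicM ?monic_neq0.
have sp : (0 < size p)%N by rewrite size_poly_gt0 monic_neq0.
have pk : (size p < k)%N by move: fk; rewrite sf; lia.
have pn : (size p <= n)%N by move: fn; rewrite sf; lia.
have IHp := IHk p pk pm (leqW pn).
have sh : size h = (size h).-1.+1 by rewrite prednK // ltnW.
rewrite sf.
have -> : ((size h + size p).-1.-1 = (size p).-1 + (size h).-1)%N by lia.
rewrite -IHp (_ : (size h).-1 = \sum_(1 <= d < n.+1) \sum_(g <- monics (@irreducible_poly F) d) d * (g == h))%N.
  rewrite -big_split /=; apply: eq_bigr => d _; rewrite -big_split /=.
  rewrite big_seq [RHS]big_seq; apply: eq_bigr => g /monicsP[gm _ gi].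
  by rewrite e irr_multM // ?mulnDr //; lia.
transitivity (\sum_(1 <= d < n.+1) (d == (size h).-1) * d)%N.
  rewrite (bigD1_seq (size h).-1) ?iota_uniq ?mem_index_iota //=.
    by rewrite eqxx mul1n big1 ?addn0 // => d /negbTE ->.
  by move: pn; rewrite sh in sf h1 *; move: fn f1; rewrite sf; lia.
apply: eq_bigr => d _; rewrite -big_distrr /= mulnC; congr (_ * _)%N.
transitivity (count_mem h (monics (@irreducible_poly F) d)); last first.
  by rewrite -sum1_count big_mkcond.
rewrite count_uniq_mem ?monics_uniq //; congr nat_of_bool; apply/eqP/monicsP => [->|[_ hs _]].
  by split.
by rewrite hs.
Qed.

(** Both sides are the sum of the degrees of all monic polynomials of degree [n]: on the right, an
    irreducible [g] of degree [d] contributes [d] for each [j] such that [g ^+ j] divides the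
    polynomial. This replaces the Euler product. *)
Lemma degree_count (F : finFieldType) n :
  (n * #|F| ^ n = \sum_(1 <= d < n.+1) \sum_(1 <= j < n.+1)
     (j * d <= n) * (d * num_irreducible F d * #|F| ^ (n - j * d)))%N.
Proof.
transitivity (\sum_(f <- monics (fun _ : {poly F} => True) n) (size f).-1)%N.
  rewrite big_seq (eq_bigr (fun _ => n)) => [|f /monicsP[_ -> _] //].
  by rewrite -big_seq big_const_seq count_predT iter_addn_0 size_monics num_monic_true.
under eq_big_seq => f /monicsP[fm fs _] do rewrite -(@sum_irr_degree F n f) ?fs //.
rewrite exchange_big /=; apply: eq_bigr => d _.
rewrite exchange_big /= /irr_mult.
under eq_bigr => g _ do rewrite -big_distrr /= exchange_big /=.
rewrite big_seq.
under eq_bigr => g /monicsP[gm gs _].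
  under eq_bigr => j _.
    rewrite (@count_dvd_monics F (g ^+ j) (j * d)%N) ?rpredX //; last first.
      by rewrite size_exp_monic // gs /= mulnC.
    over.
  over.
rewrite -big_seq big_const_seq count_predT iter_addn_0 size_monics -/(num_irreducible F d).
by rewrite mulnC big_distrr big_distrr /=; apply: eq_bigr => j _; lia.
Qed.

(** In [degree_count] at [n + 1] the terms with [j d <= n] are [q] times those at [n]; subtracting
    leaves the terms [j d = n + 1], one per divisor [d]. *)
Lemma sum_dvdn_irreducible (F : finFieldType) n : (0 < n)%N ->
  (\sum_(1 <= d < n.+1 | d %| n) d * num_irreducible F d = #|F| ^ n)%N.
Proof.
case: n => // n _; have := degree_count F n.+1.
set I := num_irreducible F; set q := #|F|.
have -> : (\sum_(1 <= d < n.+2) \sum_(1 <= j < n.+2)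
     (j * d <= n.+1) * (d * I d * q ^ (n.+1 - j * d)) =
   \sum_(1 <= d < n.+2 | d %| n.+1) d * I d +
   q * \sum_(1 <= d < n.+1) \sum_(1 <= j < n.+1)
     (j * d <= n) * (d * I d * q ^ (n - j * d)))%N.
  transitivity (\sum_(1 <= d < n.+2) ((d %| n.+1) * (d * I d) +
     q * \sum_(1 <= j < n.+1) (j * d <= n) * (d * I d * q ^ (n - j * d))))%N; last first.
    rewrite big_split /= -big_distrr /=; congr (_ + q * _)%N.
      by rewrite [RHS]big_mkcond /=; apply: eq_bigr => d _; case: dvdn; rewrite ?mul1n.
    rewrite big_nat_recr //= [X in (_ + X)%N](_ : _ = 0)%N ?addn0 //.
    rewrite big_nat big1 // => j /andP[j1 _].
    by rewrite  leqNgt (leq_trans (ltnSn n)) // leq_pmull.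
  apply: eq_big_nat => d /andP[d1 dn].
  transitivity (\sum_(1 <= j < n.+2) ((j * d == n.+1) * (d * I d) +
     q * ((j * d <= n) * (d * I d * q ^ (n - j * d)))))%N.
    apply: eq_bigr => j _; have [->|njd] := eqVneq (j * d)%N n.+1.
      by rewrite leqnn subnn ltnn expn0 !mul0n !muln0 muln1 addn0.
    rewrite leq_eqVlt (negbTE njd) /= ltnS mul0n add0n.
    case: leqP => jd; rewrite ?mul0n ?muln0 // !mul1n subSn // expnS; lia.
  rewrite big_split /= -big_distrl -big_distrr /=; congr (_ * _ + q * _)%N.
    have [/dvdnP[j nE]|nd] := boolP (d %| n.+1)%N; last first.
      by apply: big1 => j _; apply/eqP; rewrite eqb0; apply: contra nd => /eqP <-; rewrite dvdn_mull.
    rewrite (bigD1_seq j) ?iota_uniq ?mem_index_iota //=.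
      rewrite nE eqxx big1 // => i ij; apply/eqP; rewrite eqb0.
      by apply: contra ij; rewrite eqn_pmul2r.
    by move: nE d1; case: j => [|j]; nia.
  rewrite big_nat_recr //= leqNgt (leq_trans (ltnSn n)) ?leq_pmulr //.
  by rewrite mul0n addn0.
rewrite -degree_count => h; apply/eqP; rewrite -(eqn_add2r (q * (n * q ^ n))%N) -h.
by rewrite mulSn expnS mulnCA.
Qed.

Definition irr_density (R : numFieldType) (F : finFieldType) (k : nat) : R :=
  (num_irreducible F k)%:R / #|F|%:R ^+ k.

Lemma card_field_neq0 (R : numFieldType) (F : finFieldType) : #|F|%:R != 0 :> R.
Proof. by rewrite pnatr_eq0 -lt0n; apply/card_gt0P; exists 0. Qed.

Lemma prob_coef (R : numFieldType) (F : finFieldType) (n : nat) :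
  (num_distinct_degree F n)%:R / #|F|%:R ^+ n =
  (\prod_(1 <= k < n.+1) (1 + irr_density R F k *: 'X^k))`_n :> R.
Proof.
(* The length of the product is separated from the index of the coefficient, so that the induction
   can run on the length alone. *)
rewrite num_distinct_degreeE; move: {1 4}n => k.
elim: k n => [|k IHk] n.
  rewrite num_distinct_degree_upto0 big_nil coef1.
  by case: n => [|n]; rewrite ?mul0r // expr0 divr1.
rewrite big_nat_recr //= mulrDr mulr1 coefD -scalerAr coefZ coefMXn -!IHk.
rewrite num_distinct_degree_uptoS natrD mulrDl; congr (_ + _).
case: ltnP => kn; last by rewrite ltnS kn mulr0 mul0n mul0r.
rewrite ltnS leqNgt kn /= mul1n natrM /irr_density -{2}(subnK kn) exprD.
by field; rewrite !expf_neq0 // card_field_neq0.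
Qed.

Lemma sum_irr_density (R : numFieldType) (F : finFieldType) (n : nat) : (0 < n)%N ->
  \sum_(1 <= d < n.+1 | (d %| n)%N) d%:R * irr_density R F d * #|F|%:R ^- (n - d) = 1.
Proof.
move=> n0; have q0 := card_field_neq0 R F.
have := congr1 (fun m => m%:R / #|F|%:R ^+ n : R) (sum_dvdn_irreducible F n0).
rewrite natrX divff ?expf_neq0 // natr_sum mulr_suml => /esym e; rewrite [RHS]e.
rewrite big_nat_cond [RHS]big_nat_cond; apply: eq_bigr => d /andP[/andP[_ dn] _].
rewrite ltnS in dn; rewrite natrM /irr_density -[in RHS](subnK dn) exprD.
by field; rewrite !expf_neq0.
Qed.

(** * Convolution and logarithmic derivatives *)

Definition convol (R : comNzRingType) (x y : nat -> R) (n : nat) : R :=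
  \sum_(k < n.+1) x k * y (n - k)%N.

(** A coefficient of index [n] only sees truncations, so the algebra of convolutions is inherited
    from polynomial multiplication. *)
Lemma convol_poly (R : comNzRingType) (x y : nat -> R) n N : (n < N)%N ->
  convol x y n = (\poly_(i < N) x i * \poly_(i < N) y i)`_n.
Proof.
move=> nN; rewrite coefM; apply: eq_bigr => k _.
have kn : (k <= n)%N by rewrite -ltnS.
by rewrite !coef_poly (leq_ltn_trans kn nN) (leq_ltn_trans (leq_subr k n) nN).
Qed.

Lemma convol_coef (R : comNzRingType) (p r : {poly R}) :
  convol (fun n => p`_n) (fun n => r`_n) = fun n => (p * r)`_n.
Proof. by apply/funext => n; rewrite coefM. Qed.

Lemma convolC (R : comNzRingType) (x y : nat -> R) : convol x y = convol y x.
Proof. by apply/funext => n; rewrite !(convol_poly _ _ (ltnSn n)) mulrC. Qed.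

Lemma eq_convol_l (R : comNzRingType) (x y z : nat -> R) n :
  (forall k, (k <= n)%N -> x k = y k) -> convol x z n = convol y z n.
Proof. by move=> xy; apply: eq_bigr => k _; rewrite xy // -ltnS. Qed.

Lemma convolA (R : comNzRingType) (x y z : nat -> R) :
  convol x (convol y z) = convol (convol x y) z.
Proof.
apply/funext => n; pose P (u : nat -> R) := \poly_(i < n.+1) u i.
have PM u v k : (k <= n)%N -> convol u v k = (P u * P v)`_k.
  by move=> kn; rewrite (@convol_poly _ _ _ k n.+1).
transitivity ((P x * (P y * P z))`_n).
  rewrite convolC (eq_convol_l _ (PM y z)) convolC coefM; apply: eq_bigr => k _.
  by rewrite /P coef_poly ltn_ord.
rewrite (eq_convol_l _ (PM x y)) mulrA coefM; apply: eq_bigr => k _.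
by rewrite [(P z)`__]coef_poly ltnS leq_subr.
Qed.

Lemma convolCA (R : comNzRingType) (x y z : nat -> R) :
  convol x (convol y z) = convol y (convol x z).
Proof. by rewrite convolA (convolC x) -convolA. Qed.

Lemma convolDl (R : comNzRingType) (x y z : nat -> R) :
  convol (fun n => x n + y n) z = fun n => convol x z n + convol y z n.
Proof.
by apply/funext => n; rewrite -big_split; apply: eq_bigr => k _; rewrite mulrDl.
Qed.

Lemma convolDr (R : comNzRingType) (x y z : nat -> R) :
  convol z (fun n => x n + y n) = fun n => convol z x n + convol z y n.
Proof. by rewrite convolC convolDl; apply/funext => n; rewrite !(convolC z). Qed.

Lemma convol_suml (R : comNzRingType) (I : Type) (s : seq I) (x : I -> nat -> R) z :
  convol (fun n => \sum_(i <- s) x i n) z = fun n => \sum_(i <- s) convol (x i) z n.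
Proof.
apply/funext => n; rewrite exchange_big; apply: eq_bigr => k _.
by rewrite mulr_suml.
Qed.

Definition nder (R : nzRingType) (x : nat -> R) (n : nat) : R := n%:R * x n.

Lemma nder_conv (R : comNzRingType) (x y : nat -> R) :
  nder (convol x y) = fun n => convol (nder x) y n + convol x (nder y) n.
Proof.
apply/funext => n; rewrite -big_split /nder mulr_sumr; apply: eq_bigr => k _.
have kn : (k <= n)%N by rewrite -ltnS.
by rewrite -{1}(subnKC kn) natrD /=; ring.
Qed.

(* The sequence [c] lists the coefficients of [z p' / p]. *)
Definition log_deriv (R : comNzRingType) (p : {poly R}) (c : nat -> R) : Prop :=
  nder (fun n => p`_n) = convol c (fun n => p`_n).

Lemma log_deriv1 (R : comNzRingType) : log_deriv (1 : {poly R}) (fun _ => 0).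
Proof.
apply/funext => n; rewrite /nder coef1 /convol big1 => [|k _]; last by rewrite mul0r.
by case: n => [|n]; rewrite ?mul0r ?mulr0.
Qed.

Lemma log_derivM (R : comNzRingType) (p r : {poly R}) c d :
  log_deriv p c -> log_deriv r d -> log_deriv (p * r) (fun n => c n + d n).
Proof.
move=> pc rd; rewrite /log_deriv -convol_coef nder_conv pc rd convolDl.
by rewrite (convolCA (fun n => p`_n) d) -convolA.
Qed.

Lemma log_derivX (R : comNzRingType) (p : {poly R}) c m :
  log_deriv p c -> log_deriv (p ^+ m) (fun n => m%:R * c n).
Proof.
move=> pc; elim: m => [|m IHm].
  rewrite expr0 (_ : (fun _ => _) = fun _ => 0); first exact: log_deriv1.
  by apply/funext => n; rewrite mul0r.
rewrite exprS (_ : (fun _ => _) = fun n => c n + m%:R * c n); first exact: log_derivM.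
by apply/funext => n; rewrite -natr1 mulrDl mul1r addrC.
Qed.

(** The geometric series of [k b z^k / (1 + b z^k)]; multiplied back by [1 + b z^k], it telescopes
    to its term at [n = k]. *)
Lemma log_deriv_binomial (R : comNzRingType) (b : R) k : (0 < k)%N ->
  log_deriv (1 + b *: 'X^k)
    (fun n => ((0 < n) && (k %| n))%N%:R * - (k%:R * (- b) ^+ (n %/ k))).
Proof.
move=> k0; set c := fun n => _; apply/funext => n.
rewrite convolC /nder /convol.
have cf j : (1 + b *: 'X^k)`_j = (j == 0%N)%:R + b * (j == k)%:R.
  by rewrite coefD coef1 coefZ coefXn.
under eq_bigr => j _ do rewrite cf mulrDl.
rewrite big_split /= (bigD1 ord0) //= big1 ?addr0 => [|j j0]; last first.
  by rewrite (negbTE (_ : (j : nat) != 0%N)) ?mul0r.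
rewrite subn0 mul1r cf.
have [kn|nk] := leqP k n; last first.
  rewrite big1 ?addr0 => [|j _]; last first.
    by rewrite ltn_eqF ?mulr0 ?mul0r //; apply: leq_trans nk.
  rewrite (ltn_eqF nk) mulr0 addr0 /c.
  case: n nk => [|n] nk; rewrite ?mul0r //= mulr0.
  by rewrite gtnNdvd ?mul0r.
rewrite (bigD1 (Ordinal (kn : (k < n.+1)%N))) //= big1 ?addr0 => [|j jk]; last first.
  by rewrite (negbTE (_ : (j : nat) != k)) ?mulr0 ?mul0r.
rewrite eqxx mulr1 /c (gtn_eqF (leq_trans k0 kn)) (leq_trans k0 kn) add0r /=.
have [->|nek] := eqVneq n k.
  by rewrite subnn /= dvdnn divnn k0 expr1 mulr1 !mul0r mulr0 addr0 mul1r mulrN opprK.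
have ltkn : (k < n)%N by rewrite ltn_neqAle eq_sym nek.
rewrite subn_gt0 ltkn dvdn_subl ?dvdnn // ?mulr0.
case: (boolP (k %| n)%N) => dkn; last by rewrite !mul0r mulr0 addr0.
have -> : (n %/ k = ((n - k) %/ k).+1)%N.
  by rewrite -{1}(subnK kn) divnDr // divnn k0 addn1.
by rewrite exprS; ring.
Qed.

(** Since [c 0 = 0], the recurrence [n p_n = sum_k c_k p_(n-k)] determines [p_n] from the earlier
    coefficients. Product identities are checked this way on logarithmic derivatives, without
    exponentials of series. *)
Lemma log_deriv_uniq (R : numDomainType) (p r : {poly R}) c d N :
  log_deriv p c -> log_deriv r d -> c 0%N = 0 -> d 0%N = 0 -> p`_0 = r`_0 ->
  (forall n, (0 < n <= N)%N -> c n = d n) -> forall n, (n <= N)%N -> p`_n = r`_n.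
Proof.
move=> pc rd c0 d0 pr0 cd; elim/ltn_ind => -[//|n] IHn nN.
apply: (@mulfI _ n.+1%:R); first by rewrite pnatr_eq0.
have := congr1 (fun f => f n.+1) pc; have := congr1 (fun f => f n.+1) rd.
rewrite /nder /= => -> ->; rewrite /convol [LHS]big_ord_recl [RHS]big_ord_recl /= c0 d0 !mul0r; congr (_ + _).
apply: eq_bigr => k _; rewrite /bump /= add1n.
rewrite cd //=; last by rewrite (leq_trans _ nN).
by rewrite IHn ?(leq_trans _ nN) //; lia.
Qed.

(** * Bounds for convolutions *)

(** A summable weight strictly between the order 1 of the logarithmic derivative and the target
    order 2; the half power in between is what beats the constants in [log_deriv_bnd]. *)
Definition w32 (R : rcfType) (n : nat) : R := (n.+1%:R * Num.sqrt n.+1%:R)^-1.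

Lemma sqrtS_ge1 (R : rcfType) n : 1 <= Num.sqrt n.+1%:R :> R.
Proof. by rewrite -[leLHS]sqrtr1 ler_wsqrtr // ler1n. Qed.

Lemma sqrtS_gt0 (R : rcfType) n : 0 < Num.sqrt n.+1%:R :> R.
Proof. by rewrite sqrtr_gt0 ltr0Sn. Qed.

Lemma sqr_sqrtS (R : rcfType) n : Num.sqrt n.+1%:R ^+ 2 = n.+1%:R :> R.
Proof. by rewrite sqr_sqrtr // ler0n. Qed.

Lemma sqrtS_le (R : rcfType) n : Num.sqrt n.+1%:R <= n.+1%:R :> R.
Proof. by rewrite -[leRHS]sqr_sqrtS expr2 ler_peMr ?sqrtr_ge0 ?sqrtS_ge1. Qed.

Lemma w32_ge0 (R : rcfType) n : 0 <= w32 R n.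
Proof. by rewrite invr_ge0 mulr_ge0 ?sqrtr_ge0. Qed.

Lemma w32_telescope (R : rcfType) n :
  w32 R n <= 4 * ((Num.sqrt n.+1%:R)^-1 - (Num.sqrt n.+2%:R)^-1).
Proof.
rewrite /w32; have := sqrtS_gt0 R n; have := sqrtS_gt0 R n.+1; have := sqrtS_ge1 R n.
have : Num.sqrt n.+2%:R ^+ 2 = Num.sqrt n.+1%:R ^+ 2 + 1 :> R by rewrite !sqr_sqrtS natr1.
rewrite -{4}(sqr_sqrtS R n); move: (Num.sqrt n.+1%:R) (Num.sqrt n.+2%:R) => a b b2 a1 b0 a0.
(* With [a] and [b] the two square roots, [b^2 - a^2 = 1] rationalises the difference; what remains
   to check is [b (a + b) <= 4 a^2]. *)
have -> : a^-1 - b^-1 = (a * b * (a + b))^-1.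
  have ab : b ^+ 2 - a ^+ 2 = 1 by rewrite b2; ring.
  have : (b - a) * (a + b) = 1 by rewrite -ab; ring.
  move=> e; apply: (@mulIf _ (a * b * (a + b))).
    by rewrite !mulf_neq0 // gt_eqF // addr_gt0.
  rewrite mulVf; last by rewrite !mulf_neq0 // gt_eqF // addr_gt0.
  by rewrite -{}[RHS]e; field; rewrite !gt_eqF.
rewrite -ler_pdivrMl // -[4^-1]/(4^-1) -invfM lef_pV2 ?posrE ?mulr_gt0 ?addr_gt0 //.
  have ab : b * (a + b) <= 4 * a ^+ 2.
    have : 0 <= (a - b) ^+ 2 by rewrite sqr_ge0.
    rewrite mulrDr -expr2 b2 sqrrB b2; nra.
  have -> : 4 * (a ^+ 2 * a) = a * (4 * a ^+ 2) by ring.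
  by rewrite -mulrA ler_wpM2l // ltW.
Qed.

Lemma sum_w32_tail (R : rcfType) m n :
  \sum_(m <= k < n) w32 R k <= 4 / Num.sqrt m.+1%:R.
Proof.
have [mn|nm] := leqP m n; last by rewrite big_geq ?(ltnW nm) // divr_ge0 ?sqrtr_ge0.
apply: (@le_trans _ _ (\sum_(m <= k < n) 4 * ((Num.sqrt k.+1%:R)^-1 - (Num.sqrt k.+2%:R)^-1))).
  by apply: ler_sum => k _; exact: w32_telescope.
rewrite -big_distrr /= ler_wpM2l //.
under eq_bigr do rewrite -opprB.
rewrite sumrN telescope_sumr // opprB lerBlDr lerDl invr_ge0 sqrtr_ge0 //.
Qed.

Lemma sum_w32 (R : rcfType) n : \sum_(k < n) w32 R k <= 4.
Proof. by have := sum_w32_tail R 0 n; rewrite sqrtr1 divr1 big_mkord. Qed.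

(** Partial fractions with [(n - k + 1) + (k + 1) = n + 2]; this is where the convolution estimates
    get their decay in [n]. *)
Lemma inv_split (R : numFieldType) k n : (k <= n)%N ->
  (n - k).+1%:R^-1 * k.+1%:R^-1 = ((n - k).+1%:R^-1 + k.+1%:R^-1) / n.+2%:R :> R.
Proof.
move=> kn; have -> : n.+2%:R = (n - k).+1%:R + k.+1%:R :> R.
  by rewrite -natrD; congr (_%:R); lia.
have := ltr0Sn R (n - k); have := ltr0Sn R k.
move: k.+1%:R (n - k).+1%:R => a b a0 b0.
by field; rewrite !gt_eqF // addr_gt0.
Qed.

Lemma sum_inv_w32 (R : rcfType) n :
  \sum_(k < n.+1) (n - k).+1%:R^-1 * w32 R k <= 12 / n.+2%:R.
Proof.
(* After partial fractions, the mixed product [1 / ((n - k + 1) sqrt (k + 1))] is at most [w32] at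
   the smaller of [k] and [n - k]. Hence [w32 k] counts twice and [w32 (n - k)] once, each of total
   mass at most 4. *)
have -> : 12 = 4 + 2 * 4 :> R by ring.
have H1 : \sum_(k < n.+1) w32 R (n - k)%N <= 4.
  have <- : \sum_(k < n.+1) w32 R k = \sum_(k < n.+1) w32 R (n - k)%N.
    rewrite (reindex_inj rev_ord_inj); apply: eq_bigr => k _.
    by rewrite /= subSS.
  exact: sum_w32.
apply: (@le_trans _ _ (\sum_(k < n.+1) (w32 R (n - k)%N + 2 * w32 R k) / n.+2%:R)).
  apply: ler_sum => k _; have kn : (k <= n)%N by rewrite -ltnS.
  rewrite {1}/w32 invfM mulrA inv_split // mulrAC ler_wpM2r ?invr_ge0 //.
  rewrite mulrDl.
  have -> : k.+1%:R^-1 / Num.sqrt k.+1%:R = w32 R k by rewrite /w32 invfM.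
  have [le|/ltnW le] := leqP k (n - k)%N.
    have : (n - k).+1%:R^-1 / Num.sqrt k.+1%:R <= w32 R k.
      rewrite /w32 invfM ler_wpM2r ?invr_ge0 ?sqrtr_ge0 //.
      by rewrite lef_pV2 ?posrE ?ltr0Sn // ler_nat ltnS.
    have := w32_ge0 R (n - k)%N; move: (w32 R _) (w32 R _) (_ / _) => a b c; lra.
  have : (n - k).+1%:R^-1 / Num.sqrt k.+1%:R <= w32 R (n - k).
    rewrite /w32 invfM ler_wpM2l ?invr_ge0 //.
    by rewrite lef_pV2 ?posrE ?sqrtS_gt0 // ler_wsqrtr // ler_nat ltnS.
  have := w32_ge0 R k; move: (w32 R _) (w32 R _) (_ / _) => a b c; lra.
rewrite -big_distrl /= ler_wpM2r ?invr_ge0 // big_split /= -big_distrr /=.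
by rewrite lerD // ler_wpM2l // sum_w32.
Qed.

Definition bnd (R : numFieldType) (C : R) (s : nat) (y : nat -> R) : Prop :=
  forall n, `|y n| <= C / n.+1%:R ^+ s.

Lemma bnd_ge0 (R : numFieldType) (C : R) s y : bnd C s y -> 0 <= C.
Proof. by move=> /(_ 0%N); rewrite expr1n divr1; apply: le_trans. Qed.

Lemma bnd_w32 (R : rcfType) (C : R) s y n : (1 < s)%N -> bnd C s y -> `|y n| <= C * w32 R n.
Proof.
move=> s2 yb; apply: le_trans (yb n) _; rewrite ler_wpM2l ?(bnd_ge0 yb) //.
rewrite lef_pV2 ?posrE ?mulr_gt0 ?exprn_gt0 ?sqrtS_gt0 ?ltr0Sn //.
apply: (@le_trans _ _ (n.+1%:R ^+ 2)); first by rewrite expr2 ler_wpM2l // sqrtS_le.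
by rewrite ler_weXn2l // ler1n.
Qed.

(** Weights of order at least 2 are summable, hence stable under convolution. The factor [2 ^+ s]
    comes from bounding [(u + v)^s] by [2^s] times the larger of [u^s] and [v^s], and 8 is twice the
    mass bound 4 of [w32]. *)
Lemma convol_bnd (R : rcfType) (C D : R) s x y : (1 < s)%N -> bnd C s x -> bnd D s y ->
  bnd (C * D * 2 ^+ s * 8) s (convol x y).
Proof.
move=> s2 xb yb n; have C0 := bnd_ge0 xb; have D0 := bnd_ge0 yb.
have H1 : \sum_(k < n.+1) w32 R (n - k)%N <= 4.
  have <- : \sum_(k < n.+1) w32 R k = \sum_(k < n.+1) w32 R (n - k)%N.
    rewrite (reindex_inj rev_ord_inj); apply: eq_bigr => k _.
    by rewrite /= subSS.
  exact: sum_w32.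
apply: le_trans (ler_norm_sum _ _ _) _.
apply: (@le_trans _ _ (\sum_(k < n.+1) C * D * 2 ^+ s / n.+1%:R ^+ s * (w32 R k + w32 R (n - k)%N))).
  apply: ler_sum => k _; have kn : (k <= n)%N by rewrite -ltnS.
  rewrite normrM.
  apply: (@le_trans _ _ (C / k.+1%:R ^+ s * (D / (n - k).+1%:R ^+ s))).
    by rewrite ler_pM.
  have -> : C / k.+1%:R ^+ s * (D / (n - k).+1%:R ^+ s) =
            C * D * ((n - k).+1%:R^-1 * k.+1%:R^-1) ^+ s.
    by rewrite exprMn !exprVn; ring.
  rewrite inv_split // -!mulrA ler_wpM2l // ler_wpM2l // exprMn.
  rewrite [leLHS]mulrC [leRHS]mulrCA ler_pM ?invr_ge0 ?exprn_ge0 ?addr_ge0 ?invr_ge0 //.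
    rewrite exprVn lef_pV2 ?posrE ?exprn_gt0 ?ltr0Sn // lerXn2r ?nnegrE ?ler0n //.
    by rewrite ler_nat.
  have pw j : j.+1%:R^-1 ^+ s <= w32 R j.
    have : bnd 1 s (fun j => j.+1%:R^-1 ^+ s : R).
      by move=> i; rewrite ger0_norm ?exprn_ge0 ?invr_ge0 // exprVn mul1r.
    by move=> /(bnd_w32 j s2); rewrite mul1r ger0_norm ?exprn_ge0 ?invr_ge0.
  have aux (a b : R) : 0 <= a <= b -> (a + b) ^+ s <= 2 ^+ s * b ^+ s.
    move=> /andP[a0 ab]; rewrite -exprMn lerXn2r ?nnegrE //; lra.
  have [le|/ltnW le] := leqP k (n - k)%N.
    apply: le_trans (aux _ _ _) _.
      by rewrite invr_ge0 ler0n lef_pV2 ?posrE ?ltr0Sn // ler_nat ltnS.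
    rewrite ler_wpM2l ?exprn_ge0 //; apply: le_trans (pw _) _.
    by rewrite lerDl w32_ge0.
  rewrite addrC; apply: le_trans (aux _ _ _) _.
    by rewrite invr_ge0 ler0n lef_pV2 ?posrE ?ltr0Sn // ler_nat ltnS.
  rewrite ler_wpM2l ?exprn_ge0 //; apply: le_trans (pw _) _.
  by rewrite lerDr w32_ge0.
rewrite -big_distrr /= mulrAC -[leRHS]mulrA [8 / _]mulrC mulrA.
rewrite mulrAC ler_wpM2l //.
  by rewrite divr_ge0 ?mulr_ge0 ?exprn_ge0.
by rewrite big_split /=; have := sum_w32 R n.+1; lra.
Qed.

Lemma sqrt_sqr (R : rcfType) (x : R) : 0 <= x -> Num.sqrt (x ^+ 2) = x.
Proof. by move=> x0; rewrite sqrtr_sqr ger0_norm. Qed.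

Lemma convol_le (R : rcfType) (C K : R) c u n : c 0%N = 0 -> bnd C 1 c -> 0 <= K ->
  (forall k, (k < n)%N -> `|u k| <= K * w32 R k) ->
  `|convol c u n| <= C * K * (12 / n.+2%:R).
Proof.
move=> c0 cb K0 ub; have C0 := bnd_ge0 cb.
rewrite convolC; apply: le_trans (ler_norm_sum _ _ _) _.
apply: (@le_trans _ _ (\sum_(k < n.+1) C * K * ((n - k).+1%:R^-1 * w32 R k))); last first.
  by rewrite -big_distrr /= ler_wpM2l ?mulr_ge0 // sum_inv_w32.
apply: ler_sum => k _; rewrite normrM.
have := ltn_ord k; rewrite ltnS leq_eqVlt => /orP[/eqP ->|kn].
  by rewrite subnn c0 normr0 mulr0 !mulr_ge0 ?w32_ge0 ?invr_ge0.
rewrite mulrC mulrACA ler_pM ?ub //.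
Qed.

(** [K] depends on [C] alone, which gives uniformity over the finite subproducts. One pass of the
    recurrence on a bound [K1 w32] returns [12 C K1 / (n (n + 2))], below [K1 w32 n] as soon as
    [sqrt (n + 1) >= 24 C]; smaller [n] are covered by the crude bound [(1 + C)^n]. A second pass
    reaches order 2. *)
Lemma log_deriv_bnd (R : realType) (C : R) : exists K : R, forall c u : nat -> R,
  c 0%N = 0 -> bnd C 1 c -> `|u 0%N| <= 1 -> nder u = convol c u -> bnd K 2 u.
Proof.
have [C0|C0] := leP 0 C; last first.
  by exists 0 => c u _ /bnd_ge0; rewrite leNgt C0.
(* [576] is the square of 24, so [24 C <= sqrt (n + 1)] beyond [n0]. The constant [K1] absorbs the
   indices up to [n0], where [w32 n >= (n0 + 1)^(-2)]. *)
pose n0 := Num.bound (576 * C ^+ 2).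
have n0P : 576 * C ^+ 2 < n0%:R by apply: archi_boundP; rewrite mulr_ge0 ?sqr_ge0.
pose K1 : R := (1 + C) ^+ n0 * n0.+1%:R ^+ 2.
have C1 : 1 <= 1 + C by rewrite lerDl.
have K10 : 0 <= K1 by rewrite mulr_ge0 ?exprn_ge0 // ltW // ltr_pwDl.
exists (24 * (C * K1) + 1) => c u c0 cb u0 uc.
have ucn n : n%:R * `|u n| = `|convol c u n|.
  by rewrite -uc /nder normrM normr_nat.
have crude n : `|u n| <= (1 + C) ^+ n.
  elim/ltn_ind: n => -[_|n IHn]; first by rewrite expr0.
  have n1 : 0 < n.+1%:R :> R by rewrite ltr0Sn.
  rewrite -(ler_pM2l n1) ucn convolC; apply: le_trans (ler_norm_sum _ _ _) _.
  rewrite big_ord_recr /= subnn c0 mulr0 normr0 addr0.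
  apply: (@le_trans _ _ (\sum_(k < n.+1) (1 + C) ^+ n.+1)); last first.
    by rewrite sumr_const card_ord mulr_natl.
  apply: ler_sum => k _; rewrite normrM exprS mulrC ler_pM //.
    apply: le_trans (cb _) _; rewrite expr1 ler_pdivrMr ?ltr0Sn //.
    apply: (@le_trans _ _ ((1 + C) * 1)); first by rewrite mulr1 lerDr.
    by rewrite ler_wpM2l ?(le_trans _ C1) // ler1n.
  apply: le_trans (IHn k _) _ => //.
  by rewrite ler_weXn2l // -ltnS.
have half n : (0 < n)%N -> n.+1%:R ^+ 2 <= 2 * (n%:R * n.+2%:R) :> R.
  by move=> n1; rewrite -!natrX -!natrM ler_nat; nia.
have stage1 n : `|u n| <= K1 * w32 R n.
  elim/ltn_ind: n => n IHn.
  have [nn0|nn0] := leqP n n0.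
    apply: le_trans (crude n) _; rewrite /K1 -mulrA -[leLHS]mulr1 ler_pM ?exprn_ge0 ?(le_trans _ C1) //.
      by rewrite ler_weXn2l.
    rewrite /w32 ler_pdivlMr ?mulr_gt0 ?sqrtS_gt0 ?ltr0Sn // mul1r expr2.
    by rewrite ler_pM ?sqrtr_ge0 ?(le_trans (sqrtS_le _ _)) // ler_nat.
  have n1 : (0 < n)%N by apply: leq_ltn_trans nn0.
  have np : 0 < n%:R :> R by rewrite ltr0n.
  rewrite -(ler_pM2l np) ucn; apply: le_trans (convol_le c0 cb K10 IHn) _.
  rewrite mulrAC mulrC [leRHS]mulrCA ler_wpM2l //.
  have sC : 24 * C <= Num.sqrt n.+1%:R.
    rewrite -[leLHS]sqrt_sqr ?mulr_ge0 // ler_wsqrtr // exprMn -natrX.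
    by rewrite (le_trans (ltW n0P)) // ler_nat ltnW // ltnW.
  rewrite mulrA ler_pdivrMr ?ltr0Sn // /w32 mulrAC ler_pdivlMr ?mulr_gt0 ?sqrtS_gt0 ?ltr0Sn //.
  have h := half n n1; have s0 := sqrtS_gt0 R n; have s2 := sqr_sqrtS R n.
  rewrite -(@ler_pM2l _ 2) //; apply: le_trans h.
  have -> : 2 * (C * 12 * (n.+1%:R * Num.sqrt n.+1%:R)) = n.+1%:R * (24 * C * Num.sqrt n.+1%:R).
    by ring.
  by rewrite expr2 ler_wpM2l // -[leRHS]s2 expr2 ler_wpM2r // ltW.
(* Second pass. The factor 24 is 12 times the 2 of [half]; the summand 1 covers [n = 0]. *)
move=> [|n].
  rewrite expr1n divr1; apply: le_trans u0 _; rewrite lerDr.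
  by rewrite mulr_ge0 // (mulr_ge0 C0).
have np : 0 < n.+1%:R :> R by rewrite ltr0n.
rewrite -(ler_pM2l np) ucn; apply: le_trans (convol_le c0 cb K10 (fun k _ => stage1 k)) _.
rewrite [leLHS]mulrA [leRHS]mulrA ler_pdivrMr ?ltr0Sn // [leRHS]mulrAC.
rewrite ler_pdivlMr ?exprn_gt0 ?ltr0Sn //.
have h := half n.+1 isT.
apply: (@le_trans _ _ (C * K1 * 12 * (2 * (n.+1%:R * n.+3%:R)))).
  by rewrite ler_wpM2l // mulr_ge0 // (mulr_ge0 C0).
have -> : n.+1%:R * (24 * (C * K1) + 1) * n.+3%:R =
  C * K1 * 12 * (2 * (n.+1%:R * n.+3%:R)) + n.+1%:R * n.+3%:R :> R by ring.
by rewrite lerDl mulr_ge0.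
Qed.

(* Harmonic sums are absorbed by the factor [sqrt (n + 1)] of the error terms. *)
Definition ell (R : realType) (n : nat) : R := 1 + ln n.+1%:R.

Lemma ell_ge1 (R : realType) n : 1 <= ell R n.
Proof. by rewrite lerDl ln_ge0 // ler1n. Qed.

Lemma ell_homo (R : realType) m n : (m <= n)%N -> ell R m <= ell R n.
Proof. by move=> mn; rewrite lerD2l ler_ln ?posrE ?ltr0Sn // ler_nat. Qed.

(** With [t = ell / (2 j)], the inequality [t <= exp t] gives [t^j <= exp (ell / 2)], and
    [exp (ell n) = e (n + 1)]. *)
Lemma ell_exp_le (R : realType) j : exists2 C : R, 0 <= C &
  forall n, ell R n ^+ j <= C * Num.sqrt n.+1%:R.
Proof.
case: j => [|j].
  by exists 1 => // n; rewrite expr0 mul1r sqrtS_ge1.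
exists ((2 * j.+1)%:R ^+ j.+1 * expR 1) => [|n]; first by rewrite mulr_ge0 ?exprn_ge0 ?expR_ge0.
have x0 : 0 < n.+1%:R :> R by rewrite ltr0Sn.
set k := (2 * j.+1)%N.
have k0 : 0 < k%:R :> R by rewrite ltr0n.
pose t := ell R n / k%:R.
have t0 : 0 <= t by rewrite divr_ge0 // (le_trans _ (ell_ge1 R n)).
have lt : t <= expR t by rewrite (le_trans _ (expR_ge1Dx t)) // lerDr.
have -> : ell R n = k%:R * t by rewrite mulrC divfK // gt_eqF.
rewrite exprMn -mulrA ler_wpM2l ?exprn_ge0 //.
apply: (@le_trans _ _ (expR t ^+ j.+1)); first by rewrite lerXn2r ?nnegrE ?expR_ge0.
have e : (expR t ^+ j.+1) ^+ 2 = expR 1 * n.+1%:R.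
  rewrite -exprM mulnC -expRM_natl -/k mulrC divfK ?gt_eqF // expRD lnK //.
rewrite -[leLHS]sqrt_sqr ?exprn_ge0 ?expR_ge0 // e sqrtrM ?expR_ge0 //.
rewrite ler_wpM2r ?sqrtr_ge0 //.
have e1 : 1 <= expR 1 :> R by rewrite -expR0 ler_expR.
rewrite -[leRHS]sqrt_sqr ?expR_ge0 // ler_wsqrtr // expr2 ler_peMr ?expR_ge0 //.
Qed.

Lemma harmonic_le (R : realType) n : \sum_(k < n.+1) k.+1%:R^-1 <= ell R n.
Proof.
elim: n => [|n IHn]; first by rewrite big_ord1 invr1 /ell ln1 addr0.
rewrite big_ord_recr /=; apply: le_trans (lerD IHn (lexx _)) _.
rewrite /ell -addrA lerD2l.
have n1 : 0 < n.+1%:R :> R by rewrite ltr0Sn.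
have n2 : 0 < n.+2%:R :> R by rewrite ltr0Sn.
have -> : ln n.+1%:R = ln n.+2%:R + ln (n.+1%:R / n.+2%:R) :> R.
  by rewrite ln_div ?posrE // addrC subrK.
rewrite -addrA gerDl -lerBrDr sub0r.
have -> : n.+1%:R / n.+2%:R = 1 + - n.+2%:R^-1 :> R.
  by rewrite -[X in X / _](addrK 1) natr1 mulrBl divff ?mul1r // gt_eqF.
apply: le_ln1Dx.
by rewrite ltrN2 invf_lt1 ?ltr1n ?ltr0n.
Qed.

(** At order 1 a convolution costs a harmonic sum, that is, one more power of [ell]. *)
Lemma convol_ell (R : realType) (C D : R) m x y : bnd C 1 x ->
  (forall n, `|y n| <= D * ell R n ^+ m / n.+1%:R) ->
  forall n, `|convol x y n| <= C * D * 2 * ell R n ^+ m.+1 / n.+1%:R.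
Proof.
move=> xb yb n; have C0 := bnd_ge0 xb.
have D0 : 0 <= D.
  by have := le_trans (normr_ge0 _) (yb 0%N); rewrite /ell ln1 addr0 expr1n mulr1 divr1.
have l0 k : 0 <= ell R k := le_trans ler01 (ell_ge1 R k).
apply: le_trans (ler_norm_sum _ _ _) _.
apply: (@le_trans _ _ (\sum_(k < n.+1)
  C * D * ell R n ^+ m / n.+1%:R * ((n - k).+1%:R^-1 + k.+1%:R^-1))).
  apply: ler_sum => k _; have kn : (k <= n)%N by rewrite -ltnS.
  rewrite normrM.
  apply: (@le_trans _ _ (C / k.+1%:R * (D * ell R n ^+ m / (n - k).+1%:R))).
    rewrite ler_pM //.
    apply: le_trans (yb _) _; rewrite ler_wpM2r ?invr_ge0 // ler_wpM2l //.
    by rewrite lerXn2r ?nnegrE // ell_homo // leq_subr.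
  have -> : C / k.+1%:R * (D * ell R n ^+ m / (n - k).+1%:R) =
      C * D * ell R n ^+ m * ((n - k).+1%:R^-1 * k.+1%:R^-1) by ring.
  rewrite inv_split // -[leRHS]mulrA ler_wpM2l ?mulr_ge0 ?exprn_ge0 // mulrC.
  rewrite ler_wpM2r ?addr_ge0 ?invr_ge0 // lef_pV2 ?posrE ?ltr0Sn //.
  by rewrite ler_nat.
rewrite -big_distrr /= big_split /=.
have -> : \sum_(k < n.+1) (n - k).+1%:R^-1 = \sum_(k < n.+1) k.+1%:R^-1 :> R.
  rewrite [RHS](reindex_inj rev_ord_inj); apply: eq_bigr => k _.
  by rewrite /= subSS.
have h := harmonic_le R n.
have -> : C * D * 2 * ell R n ^+ m.+1 / n.+1%:R =
  C * D * ell R n ^+ m / n.+1%:R * (ell R n + ell R n) by rewrite exprS; ring.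
by rewrite ler_wpM2l ?lerD // !mulr_ge0 ?exprn_ge0 ?invr_ge0.
Qed.

(** * Asymptotic expansions *)

Lemma periodic_seqM (T : Type) (c : nat -> T) t : (forall n, c (n + t)%N = c n) ->
  forall m n, c (n + m * t)%N = c n.
Proof.
by move=> ct; elim=> [|m IHm] n; rewrite ?addn0 // mulSn addnA IHm ct.
Qed.

Lemma periodic_modn (T : Type) (c : nat -> T) t : (forall n, c (n + t)%N = c n) ->
  forall n, c n = c (n %% t)%N.
Proof. by move=> ct n; rewrite {1}(divn_eq n t) addnC (periodic_seqM ct). Qed.

Lemma periodic_const (T : Type) (a : T) : periodic_seq (fun _ => a).
Proof. by exists 1%N. Qed.

Lemma periodic_comp (T U : Type) (f : T -> U) c :
  periodic_seq c -> periodic_seq (fun n => f (c n)).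
Proof. by case=> t t0 ct; exists t => // n; rewrite ct. Qed.

Lemma periodic_comp2 (T U V : Type) (f : T -> U -> V) c d :
  periodic_seq c -> periodic_seq d -> periodic_seq (fun n => f (c n) (d n)).
Proof.
case=> t t0 ct [u u0 du]; exists (t * u)%N => [|n]; first by rewrite muln_gt0 t0.
by rewrite {1}mulnC (periodic_seqM ct) (periodic_seqM du).
Qed.

Lemma periodic_shift (T : Type) (c : nat -> T) m :
  periodic_seq c -> periodic_seq (fun n => c (n + m)%N).
Proof. by case=> t t0 ct; exists t => // n; rewrite addnAC ct. Qed.

Lemma periodic_bounded (R : numDomainType) (c : nat -> R) :
  periodic_seq c -> exists2 B, 0 <= B & forall n, `|c n| <= B.
Proof.
case=> t t0 ct; exists (\sum_(i < t) `|c i|) => [|n]; first by rewrite sumr_ge0.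
rewrite (periodic_modn ct) (bigD1 (Ordinal (ltn_pmod n t0))) //= lerDl.
by rewrite sumr_ge0.
Qed.

(** Once the mean over a period is subtracted, partial sums are periodic again; they form the
    discrete primitive for summation by parts. *)
Lemma periodic_mean (R : numFieldType) (c : nat -> R) : periodic_seq c ->
  exists mu d, periodic_seq d /\ forall n, c n = mu + (d n.+1 - d n).
Proof.
case=> t t0 ct; pose mu := (\sum_(i < t) c i) / t%:R.
pose d n := \sum_(i < n) (c i - mu); exists mu, d; split; last first.
  by move=> n; rewrite /d big_ord_recr /= addrAC subrr add0r addrC subrK.
exists t => // n; elim: n => [|n IHn]; last by rewrite addSn /d !big_ord_recr /= -/(d _) IHn ct.
rewrite add0n /d big_ord0 sumrB sumr_const card_ord -mulr_natr divfK ?subrr //.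
by rewrite pnatr_eq0 -lt0n.
Qed.

(** Order [s + 1/2]: small enough to be [o(n^(-s))], large enough to contain [ln^j / n^l] for all
    [l > s] and all [j]. *)
Definition errw (R : rcfType) (s n : nat) : R := (n.+1%:R ^+ s * Num.sqrt n.+1%:R)^-1.

Definition err (R : rcfType) (s : nat) (y : nat -> R) : Prop :=
  exists2 C, 0 <= C & forall n, `|y n| <= C * errw R s n.

Lemma errw_gt0 (R : rcfType) s n : 0 < errw R s n.
Proof. by rewrite invr_gt0 mulr_gt0 ?exprn_gt0 ?sqrtS_gt0. Qed.

Lemma errwS (R : rcfType) s n : errw R s.+1 n = errw R s n / n.+1%:R.
Proof. by rewrite /errw exprSr !invfM mulrAC. Qed.

Lemma errw_le (R : rcfType) s s' n : (s <= s')%N -> errw R s' n <= errw R s n.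
Proof.
move=> ss; rewrite lef_pV2 ?posrE ?mulr_gt0 ?exprn_gt0 ?sqrtS_gt0 //.
by rewrite ler_wpM2r ?sqrtr_ge0 // ler_weXn2l // ler1n.
Qed.

Lemma err_le (R : rcfType) s (y z : nat -> R) :
  (forall n, `|y n| <= `|z n|) -> err s z -> err s y.
Proof. by move=> yz [C C0 zC]; exists C => // n; apply: le_trans (zC n). Qed.

Lemma err_weak (R : rcfType) s s' (y : nat -> R) : (s <= s')%N -> err s' y -> err s y.
Proof.
move=> ss [C C0 yC]; exists C => // n; apply: le_trans (yC n) _.
by rewrite ler_wpM2l // errw_le.
Qed.

Lemma errD (R : rcfType) s (y z : nat -> R) : err s y -> err s z -> err s (fun n => y n + z n).
Proof.
move=> [C C0 yC] [D D0 zD]; exists (C + D) => [|n]; first exact: addr_ge0.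
by rewrite mulrDl; apply: le_trans (ler_normD _ _) _; rewrite lerD.
Qed.

Lemma err_bounded (R : rcfType) s (c y : nat -> R) B :
  (forall n, `|c n| <= B) -> err s y -> err s (fun n => c n * y n).
Proof.
move=> cB [C C0 yC]; have B0 : 0 <= B by apply: le_trans (cB 0%N).
exists (B * C) => [|n]; first exact: mulr_ge0.
by rewrite normrM -mulrA ler_pM.
Qed.

(** Finitely many initial values form an error of every order; in particular the default values of
    [ln 0] and [1 / 0] at [n = 0] can be ignored in comparisons. *)
Lemma err_fin (R : rcfType) s (y : nat -> R) n0 :
  (forall n, (n0 <= n)%N -> y n = 0) -> err s y.
Proof.
move=> y0; exists (\sum_(i < n0) `|y i| / errw R s i) => [|n].
  by rewrite sumr_ge0 // => i _; rewrite divr_ge0 // ltW // errw_gt0.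
have [/y0 ->|nn0] := leqP n0 n.
  rewrite normr0 mulr_ge0 ?(ltW (errw_gt0 _ _ _)) // sumr_ge0 // => i _.
  by rewrite divr_ge0 // ltW // errw_gt0.
rewrite -ler_pdivrMr ?errw_gt0 // (bigD1 (Ordinal nn0)) //= lerDl sumr_ge0 // => i _.
by rewrite divr_ge0 // ltW // errw_gt0.
Qed.

Lemma normr_ln_nat (R : realType) n : `|ln n%:R : R| <= ell R n.
Proof.
case: n => [|n]; first by rewrite ln0 // normr0 (le_trans _ (ell_ge1 _ _)).
rewrite ger0_norm ?ln_ge0 ?ler1n //; apply: le_trans (ell_homo R (leqnSn n)).
by rewrite /ell lerDr.
Qed.

Lemma invr_nat_le (R : numFieldType) n : n%:R^-1 <= 2 / n.+1%:R :> R.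
Proof.
case: n => [|n]; first by rewrite invr0 divr_ge0.
by rewrite ler_pdivlMr // mulrC ler_pdivrMr // -natrM ler_nat; lia.
Qed.

Lemma err_logpow (R : realType) s j l (c : nat -> R) : periodic_seq c -> (s < l)%N ->
  err s (fun n => c n * ln n%:R ^+ j / n%:R ^+ l).
Proof.
move=> /periodic_bounded[B B0 cB] sl; have [C C0 lC] := ell_exp_le R j.
exists (B * C * 2 ^+ l) => [|n]; first by rewrite !mulr_ge0 // exprn_ge0.
rewrite -[_ / _]mulrA normrM -!mulrA ler_pM // normrM normrX.
apply: (@le_trans _ _ (C * Num.sqrt n.+1%:R * (2 / n.+1%:R) ^+ l)).
  rewrite ler_pM ?exprn_ge0 //.
    by apply: le_trans (lC n); rewrite lerXn2r ?nnegrE ?normr_ln_nat // (le_trans ler01) ?ell_ge1.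
  rewrite -exprVn ger0_norm ?exprn_ge0 ?invr_ge0 // lerXn2r ?nnegrE ?invr_ge0 ?divr_ge0 //.
  exact: invr_nat_le.
rewrite -mulrA ler_wpM2l // exprMn mulrCA ler_wpM2l ?exprn_ge0 //.
rewrite exprVn ler_pdivrMr ?exprn_gt0 // /errw mulrC ler_pdivlMr ?mulr_gt0 ?exprn_gt0 ?sqrtS_gt0 //.
rewrite mulrCA -expr2 sqr_sqrtS -exprSr ler_weXn2l // ler1n //.
Qed.

(* [asy s r y]: up to [O(n^(-s-1/2))], [y] is a finite combination of terms
   [c(n) ln(n)^j / n^l] with [c] periodic and [l >= r]. *)
Inductive asy (R : realType) (s r : nat) : (nat -> R) -> Prop :=
| asy_term c j l : periodic_seq c -> (r <= l)%N ->
    asy s r (fun n => c n * ln n%:R ^+ j / n%:R ^+ l)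
| asy_err y : err s y -> asy s r y
| asyD y z : asy s r y -> asy s r z -> asy s r (fun n => y n + z n).

Lemma eq_asy (R : realType) s r (y z : nat -> R) : y =1 z -> asy s r y -> asy s r z.
Proof. by move=> /funext ->. Qed.

Lemma asy0 (R : realType) s r : asy s r (fun _ : nat => 0 : R).
Proof. by apply/asy_err/(@err_fin _ _ _ 0). Qed.

Lemma asy_weak (R : realType) s s' r r' (y : nat -> R) :
  (s <= s')%N -> (r <= r')%N -> asy s' r' y -> asy s r y.
Proof.
move=> ss rr; elim=> [c j l pc rl|z ez|z z' _ az _ az'].
- by apply: asy_term => //; apply: leq_trans rl.
- exact/asy_err/(err_weak ss).
- exact: asyD.
Qed.

Lemma asy_periodic (R : realType) s r (c y : nat -> R) :
  periodic_seq c -> asy s r y -> asy s r (fun n => c n * y n).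
Proof.
move=> pc; elim=> [d j l pd rl|z ez|z z' _ az _ az'].
- apply: (@eq_asy _ _ _ (fun n => (c n * d n) * ln n%:R ^+ j / n%:R ^+ l)).
    by move=> n; rewrite !mulrA.
  by apply: asy_term => //; apply: periodic_comp2.
- by have [B _ cB] := periodic_bounded pc; apply/asy_err/(err_bounded cB).
- by apply: eq_asy (asyD az az') => n; rewrite mulrDr.
Qed.

Lemma asyZ (R : realType) s r a (y : nat -> R) : asy s r y -> asy s r (fun n => a * y n).
Proof. exact/asy_periodic/periodic_const. Qed.

Lemma asyN (R : realType) s r (y : nat -> R) : asy s r y -> asy s r (fun n => - y n).
Proof. by move=> /(asyZ (-1)); apply: eq_asy => n; rewrite mulN1r. Qed.

Lemma asyB (R : realType) s r (y z : nat -> R) :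
  asy s r y -> asy s r z -> asy s r (fun n => y n - z n).
Proof. by move=> ay /asyN; apply: asyD. Qed.

Lemma asy_sum (R : realType) s r (I : Type) (t : seq I) (y : I -> nat -> R) :
  (forall i, asy s r (y i)) -> asy s r (fun n => \sum_(i <- t) y i n).
Proof.
move=> ay; elim: t => [|i t IHt].
  by apply: eq_asy (asy0 _ s r) => n; rewrite big_nil.
by apply: eq_asy (asyD (ay i) IHt) => n; rewrite big_cons.
Qed.

Lemma asy_near (R : realType) s r (y z : nat -> R) n0 :
  (forall n, (n0 <= n)%N -> y n = z n) -> asy s r y -> asy s r z.
Proof.
move=> yz ay; have e : err s (fun n => z n - y n).
  by apply: (@err_fin _ _ _ n0) => n /yz ->; rewrite subrr.
by apply: eq_asy (asyD ay (asy_err r e)) => n; rewrite addrC subrK.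
Qed.

Lemma asy_logpow (R : realType) s r j l : (r <= l)%N ->
  asy s r (fun n => ln n%:R ^+ j / n%:R ^+ l : R).
Proof.
move=> rl; apply: eq_asy (asy_term s j (periodic_const 1) rl) => n.
by rewrite mul1r.
Qed.

Lemma asy_div (R : realType) s r (y : nat -> R) :
  asy s r y -> asy s.+1 r.+1 (fun n => y n / n%:R).
Proof.
elim=> [d j l pd rl|z [C C0 zC]|z z' _ az _ az'].
- apply: eq_asy (asy_term s.+1 j pd (_ : (r.+1 <= l.+1)%N)) => // n.
  by rewrite exprSr invfM !mulrA.
- apply: asy_err; exists (C * 2) => [|n]; first exact: mulr_ge0.
  rewrite normrM [`|_^-1|]ger0_norm ?invr_ge0 //.
  apply: (@le_trans _ _ (C * errw R s n * (2 / n.+1%:R))).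
    by rewrite ler_pM ?invr_ge0 // invr_nat_le.
  by rewrite le_eqVlt; apply/orP; left; apply/eqP; rewrite /errw exprSr !invfM; ring.
- by apply: eq_asy (asyD az az') => n; rewrite mulrDl.
Qed.

Lemma asy_div_iff (R : realType) s r (y : nat -> R) :
  asy s r (nder y) -> asy s.+1 r.+1 y.
Proof.
move=> /asy_div; apply: (@asy_near _ _ _ _ _ 1) => n n1.
by rewrite /nder mulrC mulKf // pnatr_eq0 -lt0n.
Qed.

(* A power of [ln] costs less than the one order lost in the error term. *)
Lemma asyM (R : realType) s r r' (y z : nat -> R) :
  asy s.+1 r y -> asy s.+1 r' z -> asy s (r + r') (fun n => y n * z n).
Proof.
have logM c j l (u : nat -> R) : periodic_seq c -> err s.+1 u ->
    err s (fun n => c n * ln n%:R ^+ j / n%:R ^+ l * u n).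
  move=> pc [C C0 uC]; have [B B0 cB] := periodic_bounded pc.
  have [D D0 lD] := ell_exp_le R j.
  exists (B * D * C) => [|n]; first by rewrite !mulr_ge0.
  rewrite !normrM -!mulrA ler_pM // ?mulr_ge0 //.
  apply: (@le_trans _ _ (D * Num.sqrt n.+1%:R * (1 * (C * errw R s.+1 n)))).
    rewrite ler_pM ?mulr_ge0 //.
      rewrite normrX; apply: le_trans (lD n).
      by rewrite lerXn2r ?nnegrE ?normr_ln_nat // (le_trans ler01) ?ell_ge1.
    rewrite ler_pM // normfV normrX normr_nat -exprVn exprn_ile1 ?invr_ge0 //.
    by case: n => [|n]; rewrite ?invr0 // invf_le1 // ler1n.
  rewrite mul1r -!mulrA ler_wpM2l // mulrCA ler_wpM2l // errwS mulrCA.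
  by rewrite ler_piMr ?(ltW (errw_gt0 _ _ _)) // ler_pdivrMr // mul1r sqrtS_le.
move=> ay az; elim: ay => [c j l pc rl|u eu|u u' _ au _ au'].
- elim: az => [d i k pd rk|v ev|v v' _ av _ av'].
  + apply: eq_asy (asy_term s (j + i) (periodic_comp2 *%R pc pd) (leq_add rl rk)) => n.
    by rewrite !exprD invfM; ring.
  + exact/asy_err/logM.
  + by apply: eq_asy (asyD av av') => n; rewrite mulrDr.
- elim: az => [d i k pd rk|v ev|v v' _ av _ av'].
  + by apply: eq_asy (asy_err _ (logM _ _ _ _ pd eu)) => n; rewrite mulrC.
  + apply: asy_err; have [C C0 uC] := eu; apply: (@err_bounded _ _ _ _ C); last exact: err_weak ev.
    move=> n; apply: le_trans (uC n) _; rewrite ler_piMr // invf_le1 ?mulr_gt0 ?exprn_gt0 ?sqrtS_gt0 //.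
    by rewrite mulr_ege1 ?sqrtS_ge1 // exprn_ege1 // ler1n.
  + by apply: eq_asy (asyD av av') => n; rewrite mulrDr.
- by apply: eq_asy (asyD au au') => n; rewrite mulrDl.
Qed.

(** For the Taylor polynomial [q] of [ln] at 1, [y q'(y)] is a geometric sum, so [ln - q] has
    derivative [(1 - y)^L / y]; the mean value theorem on [[1, 1 + x]] concludes. *)
Lemma ln1p_taylor (R : realType) L (x : R) : 0 <= x ->
  `|ln (1 + x) - \sum_(l < L) (-1) ^+ l / l.+1%:R * x ^+ l.+1| <= x ^+ L.+1.
Proof.
move=> x0; pose q : {poly R} := \sum_(l < L) ((-1) ^+ l / l.+1%:R) *: ('X - 1%:P) ^+ l.+1.
have qE y : q.[y] = \sum_(l < L) (-1) ^+ l / l.+1%:R * (y - 1) ^+ l.+1.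
  by rewrite horner_sum; apply: eq_bigr => l _; rewrite !hornerE.
have dq y : q^`().[y] * y = 1 - (1 - y) ^+ L.
  rewrite /q; elim: L {q qE} => [|n IHn].
    by rewrite big_ord0 deriv0 horner0 mul0r expr0 subrr.
  rewrite big_ord_recr derivD hornerD mulrDl IHn derivZ deriv_exp derivXsubC /=.
  have e : (-1) ^+ n * (-1) ^+ n = 1 :> R by rewrite -exprMn mulrNN mulr1 expr1n.
  transitivity (1 - (1 - y) ^+ n + (-1) ^+ n * (-1) ^+ n * (1 - y) ^+ n * y).
    rewrite mul1r hornerZ hornerMn horner_exp hornerXsubC -[X in _ * X * _]mulr_natr.
    rewrite -[y - 1]opprB [(- (1 - y)) ^+ n]exprNn.
    by field; rewrite nat1r pnatr_eq0.
  rewrite e.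
  by rewrite exprS; ring.
pose f (y : R) : R := ln y - q.[y].
have fd (y : R) : 0 < y -> is_derive y 1 f ((1 - y) ^+ L / y).
  move=> y0; have y0' : y != 0 by rewrite gt_eqF.
  have -> : (1 - y) ^+ L / y = y^-1 - q^`().[y].
    by apply: (mulIf y0'); rewrite mulfVK // mulrBl dq mulVf // subKr.
  by apply: is_deriveB; exact: is_derive1_ln.
have x1 : 1 <= 1 + x by rewrite lerDl.
have fd' (y : R) : y \in `[1, 1 + x] -> is_derive y 1 f ((1 - y) ^+ L / y).
  by rewrite in_itv /= => /andP[y1 _]; apply: fd; apply: lt_le_trans y1.
have [|c] := MVT_segment x1 (fun y yI => fd' y (subset_itv_oo_cc yI)).
  by apply: derivable_within_continuous => y /fd' [].
rewrite in_itv /= => /andP[c1 cx].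
have c0 : 0 < c by apply: lt_le_trans c1.
have f1 : f 1 = 0.
  rewrite /f ln1 qE big1 ?subrr // => l _.
  by rewrite expr0n mulr0.
rewrite f1 subr0 addrAC subrr add0r => fE.
have -> : ln (1 + x) - \sum_(l < L) (-1) ^+ l / l.+1%:R * x ^+ l.+1 = f (1 + x).
  by rewrite /f qE; congr (_ - _); apply: eq_bigr => l _; rewrite addrAC subrr add0r.
rewrite fE exprSr normrM [`|x|]ger0_norm // ler_wpM2r //.
rewrite normrM normrX normfV [`|c|]gtr0_norm //.
apply: (@le_trans _ _ (`|1 - c| ^+ L)).
  by rewrite ler_piMr ?exprn_ge0 // invf_le1.
rewrite lerXn2r ?nnegrE // distrC ger0_norm ?subr_ge0 //.
by rewrite lerBlDl.
Qed.

(** * Finite differences of powers of the logarithm over powers of n *)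

Definition fdiff (R : zmodType) (y : nat -> R) (n : nat) : R := y n.+1 - y n.

(** Iterating [1 / (n + 1) = 1 / n - (1 / (n + 1)) / n] gains one order per step. *)
Lemma asy_invS (R : realType) s : asy s 1 (fun n => n.+1%:R^-1 : R).
Proof.
elim: s => [|s IHs].
  apply: asy_err; exists 1 => // n; rewrite mul1r /errw expr0 mul1r ger0_norm ?invr_ge0 //.
  by rewrite lef_pV2 ?posrE ?sqrtS_gt0 ?ltr0Sn // sqrtS_le.
have := asyB (asy_logpow R s.+1 0 (leqnn 1)) (asy_weak (leqnn _) (leqnSn _) (asy_div IHs)).
apply: (@asy_near _ _ _ _ _ 1) => n n1; rewrite expr0 expr1 mul1r.
have n0 : n%:R != 0 :> R by rewrite pnatr_eq0 -lt0n.
by rewrite -[n.+1%:R]natr1; field; rewrite n0 natr1 pnatr_eq0.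
Qed.

Lemma fdiff_ln_nat (R : realType) n : (0 < n)%N ->
  fdiff (fun n => ln n%:R) n = ln (1 + n%:R^-1) :> R.
Proof.
move=> n0; have n0' : 0 < n%:R :> R by rewrite ltr0n.
rewrite /fdiff -ln_div ?posrE ?ltr0Sn // -natr1 mulrDl mul1r divff //.
by rewrite gt_eqF.
Qed.

Lemma asy_fdiff_ln (R : realType) s :
  asy s 2 (fun n => fdiff (fun n => ln n%:R) n - n%:R^-1 : R).
Proof.
pose T n : R := \sum_(1 <= l < s.+1) (-1) ^+ l / l.+1%:R / n%:R ^+ l.+1.
have aT : asy s 2 T.
  rewrite (_ : T = fun n => \sum_(i < s) (-1) ^+ i.+1 / i.+2%:R / n%:R ^+ i.+2).
    apply: asy_sum => i; apply: eq_asy (asyZ _ (asy_logpow R s 0 (leq_addl i 2))) => n.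
    by rewrite expr0 mul1r addn2.
  by apply/funext => n; rewrite /T big_add1 big_mkord.
have e : err s (fun n => fdiff (fun n => ln n%:R) n - n%:R^-1 - T n : R).
  (* The first summand serves [n = 0]; [2 ^+ s.+2] comes from [1 / n <= 2 / (n + 1)]. *)
  exists (`|fdiff (fun n => ln n%:R) 0 - 0^-1 - T 0%N| + 2 ^+ s.+2); first by rewrite addr_ge0 ?exprn_ge0.
  move=> [|n]; first by rewrite /errw expr1n sqrtr1 mulr1 invr1 mulr1 lerDl exprn_ge0.
  rewrite fdiff_ln_nat //.
  have -> : ln (1 + n.+1%:R^-1) - n.+1%:R^-1 - T n.+1 =
      ln (1 + n.+1%:R^-1) - \sum_(l < s.+1) (-1) ^+ l / l.+1%:R * n.+1%:R^-1 ^+ l.+1.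
    rewrite -addrA -opprD; congr (_ - _).
    rewrite -(big_mkord predT (fun l => (-1) ^+ l / l.+1%:R * n.+1%:R^-1 ^+ l.+1)).
    rewrite big_ltn // expr0 mul1r invr1 mul1r expr1; congr (_ + _).
    by apply: eq_bigr => l _; rewrite exprVn.
  apply: le_trans (ln1p_taylor _ _) _; first by rewrite invr_ge0.
  apply: (@le_trans _ _ (2 ^+ s.+2 * errw R s n.+1)); last first.
    by rewrite ler_wpM2r ?(ltW (errw_gt0 _ _ _)) // lerDr.
  apply: (@le_trans _ _ ((2 / n.+2%:R) ^+ s.+2)).
    by rewrite lerXn2r ?nnegrE ?divr_ge0 ?invr_ge0 // invr_nat_le.
  rewrite exprMn ler_wpM2l ?exprn_ge0 // exprVn /errw.
  have p1 : 0 < n.+2%:R ^+ s.+2 :> R by rewrite exprn_gt0.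
  have p2 : 0 < n.+2%:R ^+ s * Num.sqrt n.+2%:R :> R by rewrite mulr_gt0 ?exprn_gt0 ?sqrtS_gt0.
  rewrite lef_pV2 ?posrE // exprSr ler_pM ?exprn_ge0 ?sqrtr_ge0 ?sqrtS_le //.
  by rewrite ler_weXn2l // ler1n.
by apply: eq_asy (asyD aT (asy_err 2 e)) => n; rewrite addrC subrK.
Qed.

(** Here [z] stands for the derivative of [y]: it differs from the finite difference by a quantity
    of the size of a second derivative, two orders beyond [y]. *)
Definition asy_deriv (R : realType) (r : nat) (y z : nat -> R) : Prop :=
  forall s, [/\ asy s r y, asy s r.+1 z & asy s r.+2 (fun n => fdiff y n - z n)].

(** The discrete Leibniz rule has the extra term [fdiff y n * fdiff z n], whose order [r + r' + 2]
    is that of the allowed discrepancy. *)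
Lemma asy_derivM (R : realType) r r' (y y' z z' : nat -> R) :
  asy_deriv r y y' -> asy_deriv r' z z' ->
  asy_deriv (r + r') (fun n => y n * z n) (fun n => y' n * z n + y n * z' n).
Proof.
move=> yd zd s; have [ay ay' dy] := yd s.+1; have [az az' dz] := zd s.+1.
have d1 : asy s.+1 r.+1 (fdiff y).
  by apply: eq_asy (asyD ay' (asy_weak _ _ dy)) => // n; rewrite addrC subrK.
have d2 : asy s.+1 r'.+1 (fdiff z).
  by apply: eq_asy (asyD az' (asy_weak _ _ dz)) => // n; rewrite addrC subrK.
split; first exact: asyM.
  by apply: asyD; [rewrite -addSn|rewrite -addnS]; apply: asyM.
have e1 := asyM dy az; have e2 := asyM ay dz; have e3 := asyM d1 d2.
rewrite !addSn in e1; rewrite !addnS in e2; rewrite addSn addnS in e3.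
by apply: eq_asy (asyD (asyD e1 e2) e3) => n; rewrite /fdiff; ring.
Qed.

Lemma asy_deriv_ln (R : realType) : asy_deriv 0 (fun n => ln n%:R : R) (fun n => n%:R^-1).
Proof.
move=> s; split; last exact: asy_fdiff_ln.
  by apply: eq_asy (asy_logpow R s 1 (leqnn 0)) => n; rewrite expr0 divr1 expr1.
by apply: eq_asy (asy_logpow R s 0 (leqnn 1)) => n; rewrite expr0 mul1r expr1.
Qed.

Lemma asy_deriv_inv (R : realType) :
  asy_deriv 1 (fun n => n%:R^-1 : R) (fun n => - n%:R ^- 2).
Proof.
move=> s; split.
- by apply: eq_asy (asy_logpow R s 0 (leqnn 1)) => n; rewrite expr0 mul1r expr1.
- by apply: eq_asy (asyN (asy_logpow R s 0 (leqnn 2))) => n; rewrite expr0 mul1r.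
- have := asy_weak (leqnSn s) (leqnn _) (asyM (asy_logpow R s.+2 0 (leqnn 2)) (asy_invS R s.+2)).
  apply: (@asy_near _ _ _ _ _ 1) => n n1; rewrite expr0 mul1r /fdiff.
  have n0 : n%:R != 0 :> R by rewrite pnatr_eq0 -lt0n.
  by rewrite -[n.+1%:R]natr1; field; rewrite n0 natr1 pnatr_eq0.
Qed.

Lemma asy_deriv1 (R : realType) : asy_deriv 0 (fun _ => 1 : R) (fun _ => 0).
Proof.
move=> s; split; last 2 first.
- exact: asy0.
- by apply: eq_asy (asy0 R s 2) => n; rewrite /fdiff !subrr.
- by apply: eq_asy (asy_logpow R s 0 (leqnn 0)) => n; rewrite expr0 mul1r expr0 invr1.
Qed.

Lemma asy_deriv_logpow (R : realType) j r :
  asy_deriv r (fun n => ln n%:R ^+ j / n%:R ^+ r : R)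
    (fun n => (j%:R * ln n%:R ^+ j.-1 - r%:R * ln n%:R ^+ j) / n%:R ^+ r.+1).
Proof.
have hj : asy_deriv 0 (fun n => ln n%:R ^+ j : R) (fun n => j%:R * ln n%:R ^+ j.-1 / n%:R).
  elim: j => [|j IHj].
    have -> : (fun n => 0%:R * ln n%:R ^+ 0.-1 / n%:R) = fun _ : nat => 0 : R.
      by apply/funext => n; rewrite !mul0r.
    exact: asy_deriv1.
  have := asy_derivM (asy_deriv_ln R) IHj; congr asy_deriv; apply/funext => n.
    by rewrite exprS.
  case: j {IHj} => [|j]; first by rewrite !mul0r mulr0 addr0 expr0 !mul1r mulr1.
  by rewrite /= [in RHS]exprS -[j.+2%:R]natr1 exprS; ring.
have hr : asy_deriv r (fun n => n%:R ^- r : R) (fun n => - r%:R / n%:R ^+ r.+1).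
  elim: r => [|r IHr].
    have -> : (fun n => - 0%:R / n%:R ^+ 1) = fun _ : nat => 0 : R.
      by apply/funext => n; rewrite oppr0 mul0r.
    by have := asy_deriv1 R; congr asy_deriv; apply/funext => n; rewrite expr0 invr1.
  have := asy_derivM (asy_deriv_inv R) IHr; rewrite add1n.
  congr asy_deriv; apply/funext => n; first by rewrite exprS invfM.
  have [->|n0] := eqVneq (n%:R : R) 0.
    by rewrite !exprS !(mul0r, invr0, mulr0, oppr0, addr0).
  by rewrite -[r.+1%:R]natr1 !exprS; field; rewrite n0 expf_neq0.
have := asy_derivM hj hr; rewrite add0n; congr asy_deriv; apply/funext => n.
have [->|n0] := eqVneq (n%:R : R) 0; first by rewrite !exprS !(mul0r, invr0, mulr0, oppr0, addr0).
by rewrite exprS; field; rewrite n0 expf_neq0.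
Qed.

(** * Partial sums of expansions *)

Definition psum (R : zmodType) (y : nat -> R) (n : nat) : R := \sum_(k < n) y k.

Lemma psumD (R : zmodType) (y z : nat -> R) n :
  psum (fun n => y n + z n) n = psum y n + psum z n.
Proof. exact: big_split. Qed.

Lemma psumN (R : zmodType) (y : nat -> R) n : psum (fun n => - y n) n = - psum y n.
Proof. exact: sumrN. Qed.

Lemma psumZ (R : nzRingType) a (y : nat -> R) n : psum (fun n => a * y n) n = a * psum y n.
Proof. by rewrite /psum mulr_sumr. Qed.

Lemma psum_fdiff (R : zmodType) (y : nat -> R) n : psum (fdiff y) n = y n - y 0%N.
Proof.
elim: n => [|n IHn]; first by rewrite /psum big_ord0 subrr.
by rewrite /psum big_ord_recr /= -/(psum _ n) IHn /fdiff addrC addrA subrK.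
Qed.

Lemma psum_sub (R : zmodType) (y : nat -> R) m n : (m <= n)%N ->
  psum y n - psum y m = \sum_(m <= k < n) y k.
Proof.
move=> mn; rewrite /psum -!(big_mkord predT y) (big_cat_nat _ mn) //=.
by rewrite addrAC subrr add0r.
Qed.

Lemma err_psum_le (R : rcfType) s (C : R) (y : nat -> R) : 0 <= C ->
  (forall n, `|y n| <= C * errw R s.+1 n) ->
  forall m n, (m <= n)%N -> `|psum y n - psum y m| <= 4 * C * errw R s m.
Proof.
move=> C0 yC m n mn; rewrite psum_sub //; apply: le_trans (ler_norm_sum _ _ _) _.
apply: (@le_trans _ _ (\sum_(m <= k < n) C * m.+1%:R ^- s * w32 R k)).
  rewrite big_nat [leRHS]big_nat; apply: ler_sum => k /andP[mk _].
  apply: le_trans (yC k) _; rewrite -mulrA ler_wpM2l //.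
  have -> : errw R s.+1 k = k.+1%:R ^- s * w32 R k.
    by rewrite /errw /w32 exprSr -mulrA invfM.
  rewrite ler_wpM2r ?w32_ge0 // lef_pV2 ?posrE ?exprn_gt0 ?ltr0Sn //.
  by rewrite lerXn2r ?nnegrE ?ler0n // ler_nat ltnS.
rewrite -big_distrr /=.
have -> : 4 * C * errw R s m = C * m.+1%:R ^- s * (4 / Num.sqrt m.+1%:R).
  by rewrite /errw invfM; ring.
by rewrite ler_wpM2l ?sum_w32_tail // mulr_ge0 ?invr_ge0 ?exprn_ge0.
Qed.

Lemma err_psum (R : realType) s (y : nat -> R) : err s.+1 y ->
  exists l, psum y @ \oo --> l /\ err s (fun n => psum y n - l).
Proof.
move=> [C C0 yC]; have tail := err_psum_le C0 yC.
have yw n : `|y n| <= C * w32 R n.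
  apply: le_trans (yC n) _; rewrite ler_wpM2l //.
  have -> : w32 R n = errw R 1 n by rewrite /w32 /errw expr1.
  exact: errw_le.
have cv : cvgn (psum y).
  have -> : psum y = series y by apply/funext => n; rewrite /psum seriesEord.
  apply: normed_cvg; apply: (@series_le_cvg _ (fun n => `|y n|) (fun n => C * w32 R n)) => //.
    by move=> n; rewrite mulr_ge0 ?w32_ge0.
  apply: nondecreasing_is_cvgn.
    by apply: nondecreasing_series => n _ _; rewrite mulr_ge0 ?w32_ge0.
  exists (C * 4) => _ [n _ <-]; rewrite seriesEord /= -mulr_sumr.
  by rewrite ler_wpM2l // sum_w32.
exists (limn (psum y)); split; first exact: cv.
exists (4 * C) => [|n]; first exact: mulr_ge0.
have cvl : (fun m => `|psum y m - psum y n|) @ \oo --> `|limn (psum y) - psum y n|.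
  by apply: cvg_norm; apply: cvgB; [exact: cv|exact: cvg_cst].
rewrite distrC; apply: (cvgr_to_le cvl).
by exists n => // m /= nm; apply: tail.
Qed.

Lemma asy_const (R : realType) s (a : R) : asy s 0 (fun _ => a).
Proof.
by apply: eq_asy (asy_term s 0 (periodic_const a) (leqnn 0)) => n; rewrite expr0 mulr1 divr1.
Qed.

Lemma asy_errE (R : realType) s (y : nat -> R) : asy s s.+1 y -> err s y.
Proof.
elim=> [c j l pc sl|//|u v _ eu _ ev]; first exact: err_logpow.
exact: errD.
Qed.

Lemma asy_fdiffE (R : realType) s r (y z : nat -> R) : asy_deriv r y z -> asy s r.+1 (fdiff y).
Proof.
move=> /(_ s)[_ az dz]; apply: eq_asy (asyD az (asy_weak (leqnn _) (leqnSn _) dz)) => n.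
by rewrite addrC subrK.
Qed.

(* Descending induction on the order [r]: a zero-mean periodic coefficient is
   removed by summation by parts, a constant one by the antiderivative of
   [ln^j / n^r], both at the price of terms of order [r + 1]. *)
Lemma asy_psum (R : realType) s r (y : nat -> R) : (0 < r)%N ->
  asy s.+1 r y -> asy s 0 (psum y).
Proof.
have [m] := ubnP (s.+2 - r); elim: m r y => // m IHm r y mr r0 ay.
(* Beyond order [s + 1] everything is error: the partial sums converge, and their limit is the
   constant term of the expansion. *)
have [rs|sr] := leqP r s.+1; last first.
  have [l [_ el]] := err_psum (asy_errE (asy_weak (leqnn _) sr ay)).
  by apply: eq_asy (asyD (asy_const s l) (asy_err 0 el)) => n; rewrite addrC subrK.
have IH (z : nat -> R) : asy s.+1 r.+1 z -> asy s 0 (psum z) by move=> az; apply: (IHm r.+1) => //; lia.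
have logpow j c : periodic_seq c -> asy s 0 (psum (fun n => c n * ln n%:R ^+ j / n%:R ^+ r : R)).
  elim/ltn_ind: j c => j IHj c pc.
  pose g n : R := ln n%:R ^+ j / n%:R ^+ r.
  have [mu [d [pd cE]]] := periodic_mean pc.
  have ag : asy_deriv r g _ := asy_deriv_logpow R j r.
  (* Abel summation: the sum equals [d_n g_n - d_0 g_0] minus the sum of [d_(k+1) fdiff g k], and
     [fdiff g] has order [r + 1]. *)
  have by_parts : asy s 0 (psum (fun n => (d n.+1 - d n) * g n)).
    have a1 : asy s 0 (fun n => d n * g n).
      by apply: asy_periodic => //; apply: asy_logpow.
    have a2 : asy s 0 (psum (fun n => d n.+1 * fdiff g n)).
      apply: IH; apply: asy_periodic; last exact: asy_fdiffE ag.
      by have := periodic_shift 1 pd; congr periodic_seq; apply/funext => n; rewrite addn1.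
    apply: eq_asy (asyB (asyB a1 (asy_const s (d 0%N * g 0%N))) a2) => n.
    rewrite -(psum_fdiff (fun n => d n * g n)) -psumN -psumD.
    by apply: eq_bigr => k _; rewrite /fdiff; ring.
  have const : asy s 0 (psum g).
    (* For [r = 1] the antiderivative is [ln^(j+1) / (j + 1)], of order 0. *)
    have [r1|r1] := eqVneq r 1%N.
      have aG := asy_deriv_logpow R j.+1 0.
      have [_ _ dG] := aG s.+1.
      have a1 : asy s 0 (psum (fun n => fdiff (fun n => ln n%:R ^+ j.+1 / n%:R ^+ 0) n -
          (j.+1%:R * ln n%:R ^+ j.+1.-1 - 0%:R * ln n%:R ^+ j.+1) / n%:R ^+ 1 : R)).
        by apply: IH; rewrite r1.
      have a2 := asyB (asy_logpow R s j.+1 (leqnn 0)) (asy_const s (ln 0%:R ^+ j.+1 / 0%:R ^+ 0)).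
      apply: eq_asy (asyZ j.+1%:R^-1 (asyB a2 a1)) => n.
      rewrite -(psum_fdiff (fun n => ln n%:R ^+ j.+1 / n%:R ^+ 0)) -psumN -psumD -psumZ.
      apply: eq_bigr => k _; rewrite /g r1 subKr mul0r subr0 -mulrA.
      by rewrite mulKf ?pnatr_eq0.
    (* For [r >= 2] the antiderivative is sought as a multiple of [ln^j / n^(r-1)]; the by-product
       in [ln^(j-1) / n^r] falls to the inner induction on [j]. *)
    case: r r0 r1 IH IHj @g ag by_parts {mr ay rs} => [|[|r]] // _ _ IH IHj g ag by_parts.
    have aG := asy_deriv_logpow R j r.+1.
    have [_ _ dG] := aG s.+1.
    have a1 := IH _ dG.
    have a2 := asyB (asy_logpow R s j (leq0n r.+1)) (asy_const s (ln 0%:R ^+ j / 0%:R ^+ r.+1)).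
    have a3 : asy s 0 (psum (fun n => j%:R * ln n%:R ^+ j.-1 / n%:R ^+ r.+2 : R)).
      case: j {g ag by_parts aG dG a1 a2} IHj => [|j] IHj.
        apply: eq_asy (asy0 R s 0) => n.
        by rewrite /psum big1 // => k _; rewrite !mul0r.
      by apply: IHj; [rewrite ltnS|apply: periodic_const].
    apply: eq_asy (asyZ r.+1%:R^-1 (asyB a3 (asyB a2 a1))) => n.
    rewrite -(psum_fdiff (fun n => ln n%:R ^+ j / n%:R ^+ r.+1)) -psumN -psumD -psumN -psumD -psumZ.
    apply: eq_bigr => k _; rewrite /g subKr mulrBl opprB addrC subrK -mulrA.
    by rewrite mulKf ?pnatr_eq0.
  apply: eq_asy (asyD (asyZ mu const) by_parts) => n.
  by rewrite -psumZ -psumD; apply: eq_bigr => k _; rewrite -[RHS]mulrA cE [RHS]mulrDl.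
elim: ay => [c j l pc rl|z ez|u v _ au _ av].
- move: rl; rewrite leq_eqVlt => /orP[/eqP <-|rl]; first exact: logpow.
  by apply: IH; apply: asy_term.
- by apply: IH; apply: asy_err.
- by apply: eq_asy (asyD au av) => n; rewrite psumD.
Qed.

(** Grouping [k] by its residue [v] modulo the period makes [p (n - k)] a periodic function of [n]
    alone and leaves partial sums over residue classes. The index [n + (t - v)] represents [n - v]
    without truncated subtraction. *)
Lemma asy_convol_periodic (R : realType) s (p y : nat -> R) : periodic_seq p ->
  asy s.+1 1 y -> asy s 0 (convol (fun n => (0 < n)%N%:R * p n) y).
Proof.
move=> [t t0 pt] ay.
have -> : convol (fun n => (0 < n)%N%:R * p n) y =
    fun n => \sum_(v < t) p (n + (t - v))%N * psum (fun k => (k %% t == v)%N%:R * y k) n.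
  apply/funext => n; rewrite convolC /convol big_ord_recr /= subnn !mul0r mulr0 addr0.
  under [RHS]eq_bigr do rewrite mulr_sumr.
  rewrite exchange_big; apply: eq_bigr => k _ /=.
  rewrite subn_gt0 ltn_ord mul1r (bigD1 (Ordinal (ltn_pmod k t0))) //= eqxx mul1r.
  rewrite big1 ?addr0 => [|v vk]; last first.
    by rewrite (negbTE (_ : (k %% t)%N != v)) ?mul0r ?mulr0 // eq_sym.
  rewrite mulrC; congr (_ * _).
  have -> : (n + (t - k %% t) = n - k + (k %/ t).+1 * t)%N.
    have := divn_eq k t; have := ltn_pmod k t0; have := ltn_ord k.
    by move: (k %/ t)%N (k %% t)%N => a b; nia.
  by rewrite (periodic_seqM pt).
apply: asy_sum => v; apply: asy_periodic.
  by have := periodic_shift (t - v) (ex_intro2 _ _ t t0 pt : periodic_seq p).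
apply: (@asy_psum _ _ 1) => //; apply: asy_periodic => //.
by exists t => // n; rewrite modnDr.
Qed.

(** * The generating function of the probabilities *)

Lemma card_field_ge2 (R : numFieldType) (F : finFieldType) : 2 <= #|F|%:R :> R.
Proof. by rewrite ler_nat card_finNzRing_gt1. Qed.

Lemma irr_density_ge0 (R : numFieldType) (F : finFieldType) k : 0 <= irr_density R F k.
Proof. by rewrite divr_ge0 ?exprn_ge0. Qed.

Lemma invX_card_le (R : numFieldType) (F : finFieldType) k :
  #|F|%:R ^- k <= 2 ^- k :> R.
Proof.
have q2 := card_field_ge2 R F.
rewrite lef_pV2 ?posrE ?exprn_gt0 ?(lt_le_trans _ q2) //.
by rewrite lerXn2r ?nnegrE // (le_trans _ q2).
Qed.

Lemma sum_irr_density_recr (R : numFieldType) (F : finFieldType) n : (0 < n)%N ->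
  n%:R * irr_density R F n +
  \sum_(1 <= d < n | (d %| n)%N) d%:R * irr_density R F d * #|F|%:R ^- (n - d) = 1.
Proof.
move=> n0; rewrite -[RHS](sum_irr_density R F n0) [RHS]big_mkcond big_nat_recr //= -big_mkcond.
by rewrite dvdnn subnn expr0 invr1 mulr1 addrC.
Qed.

Lemma natr_irr_density_le1 (R : numFieldType) (F : finFieldType) n :
  n%:R * irr_density R F n <= 1.
Proof.
case: n => [|n]; first by rewrite mul0r.
rewrite -[leRHS](sum_irr_density_recr R F (ltn0Sn n)) lerDl sumr_ge0 // => d _.
by rewrite !mulr_ge0 ?invr_ge0 ?exprn_ge0 ?irr_density_ge0.
Qed.

Lemma irr_density_le (R : numFieldType) (F : finFieldType) n : (0 < n)%N ->
  irr_density R F n <= n%:R^-1.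
Proof.
by move=> n0; rewrite -[leRHS]mul1r ler_pdivlMr ?ltr0n // mulrC natr_irr_density_le1.
Qed.

Lemma dvdn_double_le d n : (0 < d)%N -> (d < n)%N -> (d %| n)%N -> (d.*2 <= n)%N.
Proof.
by move=> d0 dn /dvdnP[m nE]; move: dn; rewrite nE; case: m {nE} => [|[|m]]; lia.
Qed.

Lemma inv2X_half_le (R : numFieldType) d n : (d.*2 <= n)%N -> 2 ^- (n - d) <= 2 ^- n./2 :> R.
Proof. by move=> dn; rewrite lef_pV2 ?posrE ?exprn_gt0 // ler_weXn2l ?ler1n //; lia. Qed.

(** By Gauss's formula the defect is the contribution of the proper divisors of [n]; they are at
    most [n / 2] and fewer than [n] in number. *)
Lemma irr_density_defect (R : numFieldType) (F : finFieldType) n : (0 < n)%N ->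
  1 - n%:R * irr_density R F n <= n%:R * 2 ^- n./2.
Proof.
move=> n0; rewrite -{1}(sum_irr_density_recr R F n0) addrAC subrr add0r.
apply: (@le_trans _ _ (\sum_(1 <= d < n) 2 ^- n./2)); last first.
  rewrite sumr_const_nat -[leLHS]mulr_natl ler_wpM2r ?invr_ge0 ?exprn_ge0 //.
  by rewrite ler_nat leq_subr.
rewrite big_mkcond /= big_nat [leRHS]big_nat; apply: ler_sum => d /andP[d0 dn].
case: ifP => [dv|_]; last by rewrite invr_ge0 exprn_ge0.
apply: (@le_trans _ _ (1 * 2 ^- (n - d))); last first.
  by rewrite mul1r inv2X_half_le // dvdn_double_le.
by rewrite ler_pM ?mulr_ge0 ?invr_ge0 ?exprn_ge0 ?irr_density_ge0
  ?natr_irr_density_le1 ?invX_card_le.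
Qed.

Lemma expn_half_le s n : (n.+1 ^ s <= (2 * s).+2 ^ s * 2 ^ n./2)%N.
Proof.
case: s => [|s]; first by rewrite !expn0 mul1n expn_gt0.
set u := (n./2 %/ s.+1)%N.
apply: (@leq_trans ((2 * s.+1).+2 ^ s.+1 * (2 ^ u) ^ s.+1)); last first.
  by rewrite leq_mul2l -expnM leq_exp2l // leq_trunc_div orbT.
rewrite -expnMn leq_exp2r //.
have u2 : (u < 2 ^ u)%N by apply: ltn_expl.
have := divn_eq n./2 s.+1; have := ltn_pmod n./2 (ltn0Sn s); rewrite -/u.
have := odd_double_half n; move: (n./2) (n./2 %% s.+1)%N (2 ^ u)%N u2 => h t v u2.
by case: odd; nia.
Qed.

(** Here [m] is the cofactor [n / k]. For [k >= 2], [k^(m-1-s)] is at least [2^(m-1-s)], which beats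
    [m^s] up to a constant. *)
Lemma dvd_pow_le (R : realFieldType) s : exists2 C : R, 0 <= C &
  forall k m, (1 < k)%N -> (s < m)%N -> k%:R ^- m.-1 <= C / (m * k)%:R ^+ s.
Proof.
pose C : R := (2 * s).+2%:R ^+ s * 2 ^+ s; exists C; first by rewrite mulr_ge0 ?exprn_ge0.
move=> k m k1 sm.
have k0 : 0 < k%:R :> R by rewrite ltr0n ltnW.
have m0 : 0 < m%:R :> R by rewrite ltr0n (leq_trans _ sm).
rewrite natrM exprMn ler_pdivlMr ?mulr_gt0 ?exprn_gt0 // mulrC ler_pdivrMr ?exprn_gt0 //.
rewrite -(subnKC (_ : s <= m.-1)%N); last by lia.
rewrite exprD mulrCA mulrC ler_wpM2l ?exprn_ge0 //.
apply: (@le_trans _ _ (C * 2 ^+ (m.-1 - s))); last first.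
  by rewrite ler_wpM2l ?mulr_ge0 ?exprn_ge0 // lerXn2r ?nnegrE // ler_nat.
rewrite /C -mulrA -exprD -!natrX -natrM ler_nat.
case: m sm {m0} => // m sm; rewrite /= subnKC //.
apply: leq_trans (expn_half_le s m) _; rewrite leq_mul2l leq_exp2l //.
by apply/orP; right; rewrite -{2}(odd_double_half m) -addnn; lia.
Qed.

(** The cofactor [s + 2] occurs for at most one [k] and has order [s + 1]; larger cofactors have
    order [s + 2] each, and there are fewer than [n] of them. *)
Lemma sum_dvd_pow_le (R : realFieldType) s : exists2 C : R, 0 <= C & forall n, (0 < n)%N ->
  \sum_(1 <= k < n | [&& 1 < k, k %| n & s.+1 < n %/ k]%N) k%:R ^- (n %/ k).-1 <=
  C / n%:R ^+ s.+1.
Proof.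
have [C C0 CP] := dvd_pow_le R s.+1; have [D D0 DP] := dvd_pow_le R s.+2.
exists (C + D) => [|n n0]; first exact: addr_ge0.
have n0' : 0 < n%:R :> R by rewrite ltr0n.
rewrite mulrDl.
apply: (@le_trans _ _ (\sum_(1 <= k < n) ((k * s.+2 == n)%N%:R * (C / n%:R ^+ s.+1) + D / n%:R ^+ s.+2))).
  rewrite big_mkcond /=; apply: ler_sum => k _; case: ifP; last first.
    by move=> _; rewrite addr_ge0 ?mulr_ge0 ?divr_ge0 ?exprn_ge0.
  move=> /and3P[k1 kn]; have nE : (n = (n %/ k) * k)%N by rewrite divnK.
  rewrite leq_eqVlt => /orP[/eqP sE|sm].
    rewrite mulnC sE -nE eqxx mul1r; apply: le_trans (CP k (n %/ k)%N k1 _) _.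
      by rewrite -sE.
    by rewrite -nE lerDl divr_ge0 // exprn_ge0.
  apply: le_trans (DP k (n %/ k)%N k1 sm) _.
  by rewrite -nE lerDr mulr_ge0 ?divr_ge0 ?exprn_ge0.
rewrite big_split /= lerD //.
  rewrite -mulr_suml ler_piMl ?divr_ge0 ?exprn_ge0 //.
  have [/dvdnP[k nE]|nd] := boolP (s.+2 %| n)%N; last first.
    rewrite big1 // => k _; case: eqP => // nE.
    by move: nd; rewrite -nE dvdn_mull.
  have [kn|kn] := boolP (k \in index_iota 1 n); last first.
    rewrite big_seq big1 // => i iI; case: eqP => // iE.
    by move: kn; rewrite (_ : k = i) ?iI //; move: iE; rewrite nE; nia.
  rewrite (bigD1_seq k) ?iota_uniq //= big1 ?addr0 => [|i ik].
    by case: eqP; rewrite ?lexx ?ler01.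
  by rewrite nE eqn_pmul2r // (negbTE ik).
rewrite sumr_const_nat -[leLHS]mulr_natl.
have -> : D / n%:R ^+ s.+2 = D / n%:R ^+ s.+1 / n%:R by rewrite [in LHS]exprSr invfM mulrA.
rewrite mulrCA ler_piMr ?divr_ge0 ?exprn_ge0 //.
by rewrite ler_pdivrMr // mul1r ler_nat leq_subr.
Qed.

(* The factor [1 + a_1 z] is left out: as [a_1 = 1] it vanishes at [z = -1], and the
   coefficients of its logarithmic derivative do not tend to 0. *)
Definition irr_factor (R : numFieldType) (F : finFieldType) (k : nat) : {poly R} :=
  (if k == 1%N then 1 else 1 + irr_density R F k *: 'X^k) *
  (1 + (- #|F|%:R ^- k) *: 'X^k) ^+ num_irreducible F k.

Definition irr_prod (R : numFieldType) (F : finFieldType) (N : nat) : {poly R} :=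
  \prod_(1 <= k < N.+1) irr_factor R F k.

(** The two terms come from [1 + a_k z^k] and [(1 - (z / q)^k)^(I_k)]. In the second, [k I_k q^(-n)]
    is written [k a_k q^(-(n-k))], which shows the cancellation at [n = k >= 2]. *)
Definition irr_logder (R : numFieldType) (F : finFieldType) (k n : nat) : R :=
  ((0 < n) && (k %| n))%N%:R *
  ((k != 1%N)%:R * - (k%:R * (- irr_density R F k) ^+ (n %/ k)) -
   k%:R * irr_density R F k * #|F|%:R ^- (n - k)).

Lemma log_deriv_irr_factor (R : numFieldType) (F : finFieldType) k : (0 < k)%N ->
  log_deriv (irr_factor R F k) (irr_logder R F k).
Proof.
move=> k0; have q0 := card_field_neq0 R F.
have h1 : log_deriv (if k == 1%N then 1 else 1 + irr_density R F k *: 'X^k)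
    (fun n => ((0 < n) && (k %| n))%N%:R *
       ((k != 1%N)%:R * - (k%:R * (- irr_density R F k) ^+ (n %/ k)))).
  have [k1|k1] := eqVneq k 1%N.
    have := log_deriv1 R; congr log_deriv; apply/funext => n.
    by rewrite mul0r mulr0.
  have := log_deriv_binomial (irr_density R F k) k0; congr log_deriv.
  by apply/funext => n; rewrite mul1r.
have := log_derivM h1 (log_derivX (num_irreducible F k) (log_deriv_binomial (- #|F|%:R ^- k) k0)).
congr log_deriv; apply/funext => n; rewrite /irr_logder mulrBr; congr (_ + _).
case: (boolP ((0 < n) && (k %| n)))%N => [/andP[n0 kn]|_]; last by rewrite !mul0r mulr0 oppr0.
have nE : n = (n - k + k)%N by rewrite subnK // dvdn_leq.
rewrite opprK !mul1r mulrN -exprVn -exprM [(k * _)%N]mulnC divnK // exprVn.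
by rewrite /irr_density {1}nE exprD; field; rewrite !expf_neq0.
Qed.

Definition irr_logders (R : numFieldType) (F : finFieldType) (N n : nat) : R :=
  \sum_(1 <= k < N.+1) irr_logder R F k n.

Lemma log_deriv_irr_prod (R : numFieldType) (F : finFieldType) N :
  log_deriv (irr_prod R F N) (irr_logders R F N).
Proof.
rewrite /irr_prod /irr_logders; elim: N => [|N IHN].
  rewrite big_geq // (_ : (fun _ => _) = fun _ => 0); first exact: log_deriv1.
  by apply/funext => n; rewrite big_geq.
rewrite big_nat_recr //=.
rewrite (_ : (fun _ => _) = fun n => \sum_(1 <= k < N.+1) irr_logder R F k n + irr_logder R F N.+1 n).
  exact: log_derivM IHN (log_deriv_irr_factor R F (ltn0Sn N)).
by apply/funext => n; rewrite big_nat_recr.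
Qed.

Lemma irr_logder0 (R : numFieldType) (F : finFieldType) k : irr_logder R F k 0 = 0.
Proof. by rewrite /irr_logder mul0r. Qed.

Lemma irr_logders0 (R : numFieldType) (F : finFieldType) N : irr_logders R F N 0 = 0.
Proof. by rewrite /irr_logders big1 // => k _; exact: irr_logder0. Qed.

Lemma irr_logder_small (R : numFieldType) (F : finFieldType) k n : (n < k)%N ->
  irr_logder R F k n = 0.
Proof.
case: n => [|n] nk; first exact: irr_logder0.
by rewrite /irr_logder gtnNdvd // mul0r.
Qed.

Lemma irr_logders_stable (R : numFieldType) (F : finFieldType) N n : (n <= N)%N ->
  irr_logders R F N n = irr_logders R F n n.
Proof.
move=> nN; rewrite /irr_logders (big_cat_nat (n := n.+1)) //=.
rewrite [X in _ + X](_ : _ = 0) ?addr0 // big_nat big1 // => k /andP[nk _].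
exact: irr_logder_small.
Qed.

Lemma coef0_binomial (R : comNzRingType) (b : R) k : (0 < k)%N -> (1 + b *: 'X^k)`_0 = 1.
Proof. by case: k => // k _; rewrite coefD coef1 coefZ coefXn mulr0 addr0. Qed.

Lemma irr_prod_coef0 (R : numFieldType) (F : finFieldType) N : (irr_prod R F N)`_0 = 1.
Proof.
have fE (p : {poly R}) : p`_0 = p.[0] by rewrite horner_coef0.
rewrite fE /irr_prod big_nat horner_prod big1 // => k /andP[k0 _].
rewrite /irr_factor hornerM horner_exp -!fE coef0_binomial // expr1n mulr1.
by case: ifP => _; rewrite ?coef1 ?coef0_binomial.
Qed.

(** The [n]-th coefficient of the infinite product [H], read at truncation [n] since factors of
    larger index do not change it. *)
Definition irr_coef (R : numFieldType) (F : finFieldType) (n : nat) : R := (irr_prod R F n)`_n.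

Lemma irr_prod_stable (R : numFieldType) (F : finFieldType) N n : (n <= N)%N ->
  (irr_prod R F N)`_n = irr_coef R F n.
Proof.
move=> nN; apply: (log_deriv_uniq (log_deriv_irr_prod R F N) (log_deriv_irr_prod R F n)
  (N := n)); rewrite ?irr_logders0 ?irr_prod_coef0 // => j /andP[_ jn].
by rewrite irr_logders_stable ?(leq_trans jn) // irr_logders_stable.
Qed.

Definition irr_ld (R : numFieldType) (F : finFieldType) (n : nat) : R := irr_logders R F n n.

Lemma nder_irr_coef (R : numFieldType) (F : finFieldType) :
  nder (irr_coef R F) = convol (irr_ld R F) (irr_coef R F).
Proof.
apply/funext => n; have := congr1 (fun f => f n) (log_deriv_irr_prod R F n).
rewrite /nder /= -/(irr_coef R F n) => ->; apply: eq_bigr => k _.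
have kn : (k <= n)%N by rewrite -ltnS.
by rewrite irr_logders_stable // irr_prod_stable // leq_subr.
Qed.

Lemma normr_irr_logder_le (R : realFieldType) (F : finFieldType) k n :
  (0 < k)%N -> (k < n)%N -> (k %| n)%N ->
  `|irr_logder R F k n| <= (1 < k)%N%:R * k%:R ^- (n %/ k).-1 + 2 ^- n./2.
Proof.
move=> k0 kn dv; have n0 : (0 < n)%N by apply: leq_ltn_trans kn.
have a0 := irr_density_ge0 R F k.
rewrite /irr_logder n0 dv mul1r; apply: le_trans (ler_normB _ _) _; rewrite lerD //.
  have [->|k1] := eqVneq k 1%N; first by rewrite !mul0r normr0.
  have -> : (1 < k)%N by case: k k0 k1 {kn dv a0} => [|[]].
  rewrite !mul1r normrN normrM normrX normrN normr_nat ger0_norm //.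
  case E: (n %/ k)%N (divn_gt0 n k0) => [|m] /=; first by rewrite (ltnW kn).
  move=> _; rewrite exprS mulrA -[leRHS]mul1r ler_pM ?mulr_ge0 ?exprn_ge0 ?natr_irr_density_le1 //.
  by rewrite -exprVn lerXn2r ?nnegrE ?invr_ge0 // irr_density_le.
rewrite ger0_norm ?mulr_ge0 ?invr_ge0 ?exprn_ge0 //.
apply: (@le_trans _ _ (1 * 2 ^- (n - k))).
  by rewrite ler_pM ?mulr_ge0 ?invr_ge0 ?exprn_ge0 ?natr_irr_density_le1 ?invX_card_le.
by rewrite mul1r inv2X_half_le // dvdn_double_le.
Qed.

Lemma irr_logder_diag (R : numFieldType) (F : finFieldType) n : (1 < n)%N ->
  irr_logder R F n n = 0.
Proof.
move=> n1; have n0 : (0 < n)%N by apply: ltnW.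
by rewrite /irr_logder dvdnn n0 divnn n0 expr1 subnn expr0 invr1 gtn_eqF //=; ring.
Qed.

Lemma natr_half_le (R : realFieldType) s : exists2 C : R, 0 <= C &
  forall n, n%:R * 2 ^- n./2 <= C / n.+1%:R ^+ s.
Proof.
exists ((2 * s.+1).+2%:R ^+ s.+1) => [|n]; first by rewrite exprn_ge0.
rewrite ler_pdivlMr ?exprn_gt0 // mulrAC ler_pdivrMr ?exprn_gt0 //.
apply: (@le_trans _ _ (n.+1%:R ^+ s.+1)).
  by rewrite exprS ler_wpM2r ?exprn_ge0 // ler_nat.
by rewrite -!natrX -natrM ler_nat expn_half_le.
Qed.

(* Uniformly in [N]: the diagonal terms cancel and the other divisors of [n] are at most [n / 2]. *)
Lemma bnd_irr_logders (R : realFieldType) (F : finFieldType) :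
  exists C : R, forall N, bnd C 1 (irr_logders R F N).
Proof.
have [C C0 CP] := sum_dvd_pow_le R 0; have [D D0 DP] := natr_half_le R 1.
exists (C * 2 + D + 2) => N n; rewrite expr1.
case: n => [|n]; first by rewrite irr_logders0 normr0 divr_ge0 // !addr_ge0 // mulr_ge0.
rewrite ler_pdivlMr //.
case: n => [|n].
  have -> : irr_logders R F N 1 = (0 < N)%N%:R * irr_logder R F 1 1.
    case: N => [|N]; first by rewrite /irr_logders big_geq // mul0r.
    by rewrite irr_logders_stable // /irr_logders big_nat1 mul1r.
  rewrite /irr_logder /= subnn expr0 invr1 !mulr1 mul0r sub0r mul1r normrM normrN mul1r.
  rewrite [`|irr_density _ _ _|]ger0_norm ?irr_density_ge0 //.
  have h := natr_irr_density_le1 R F 1; rewrite mul1r in h.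
  apply: (@le_trans _ _ 2); last by rewrite lerDr addr_ge0 // mulr_ge0.
  rewrite -[leRHS]mul1r ler_wpM2r // normr_nat.
  by case: (0 < N)%N; rewrite ?mul1r // mul0r.
set m := n.+2; have m0 : 0 < m%:R :> R by rewrite ltr0n.
suff h : `|irr_logders R F N m| <= C / m%:R + m%:R * 2 ^- m./2.
  have h2 := DP m; rewrite expr1 ler_pdivlMr // in h2.
  apply: le_trans (ler_wpM2r _ h) _ => //; rewrite mulrDl.
  have : C / m%:R * m.+1%:R <= C * 2.
    by rewrite -mulrA ler_wpM2l // mulrC ler_pdivrMr // -natrM ler_nat /m; lia.
  by move: h2; set x := _ * _ * _; set y := _ * _ * _; lra.
apply: (@le_trans _ _ (\sum_(1 <= k < m) `|irr_logder R F k m|)).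
  have [Nm|mN] := leqP N m.-1.
    apply: le_trans (ler_norm_sum _ _ _) _; rewrite [leRHS](big_cat_nat (n := N.+1)) //=.
    by rewrite lerDl sumr_ge0.
  rewrite irr_logders_stable; last by move: mN; rewrite /m /=.
  rewrite /irr_logders big_nat_recr //= irr_logder_diag // addr0.
  exact: ler_norm_sum.
have := CP m isT; rewrite expr1 => h.
apply: (@le_trans _ _ (\sum_(1 <= k < m) ((if [&& 1 < k, k %| m & 1 < m %/ k]%N
    then k%:R ^- (m %/ k).-1 else 0) + 2 ^- m./2))).
  rewrite big_nat [leRHS]big_nat; apply: ler_sum => k /andP[k0 km].
  have [dv|ndv] := boolP (k %| m)%N; last first.
    by rewrite /irr_logder (negbTE ndv) mul0r normr0 andbF add0r invr_ge0 exprn_ge0.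
  apply: le_trans (normr_irr_logder_le R F k0 km dv) _; rewrite lerD2r.
  have -> : (1 < m %/ k)%N.
    by rewrite ltn_neqAle divn_gt0 // (ltnW km) andbT eq_sym; apply: contraTneq km => e;
      rewrite -(divnK dv) e mul1n ltnn.
  by rewrite /= andbT; case: ifP => _; rewrite ?mul1r ?mul0r.
rewrite big_split /= -big_mkcond lerD //.
rewrite sumr_const_nat -[leLHS]mulr_natl ler_wpM2r ?invr_ge0 ?exprn_ge0 //.
by rewrite ler_nat leq_subr.
Qed.

Lemma bnd_irr_prod (R : realType) (F : finFieldType) :
  exists K : R, forall N, bnd K 2 (fun n => (irr_prod R F N)`_n).
Proof.
have [C CP] := bnd_irr_logders R F; have [K KP] := log_deriv_bnd C.
exists K => N; apply: (KP (irr_logders R F N)); rewrite ?irr_logders0 ?irr_prod_coef0 ?normr1 //.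
exact: log_deriv_irr_prod.
Qed.

Lemma bnd_near (R : realFieldType) (C : R) s n0 (y : nat -> R) : 0 <= C ->
  (forall n, (n0 <= n)%N -> `|y n| <= C / n.+1%:R ^+ s) -> exists C', bnd C' s y.
Proof.
move=> C0 yC; exists (C + \sum_(i < n0) `|y i| * i.+1%:R ^+ s) => n.
have S0 : 0 <= \sum_(i < n0) `|y i| * i.+1%:R ^+ s.
  by rewrite sumr_ge0 // => i _; rewrite mulr_ge0 ?exprn_ge0.
have [nn|nn] := leqP n0 n.
  apply: le_trans (yC n nn) _; rewrite ler_wpM2r ?invr_ge0 ?exprn_ge0 // lerDl //.
rewrite ler_pdivlMr ?exprn_gt0 // (bigD1 (Ordinal nn)) //= addrCA lerDl addr_ge0 //.
by rewrite sumr_ge0 // => i _; rewrite mulr_ge0 ?exprn_ge0.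
Qed.

Lemma onem_exp_le (R : realFieldType) (t : R) m : 0 <= t <= 1 -> 1 - t ^+ m <= m%:R * (1 - t).
Proof.
move=> /andP[t0 t1]; elim: m => [|m IHm]; first by rewrite expr0 subrr mul0r.
have -> : 1 - t ^+ m.+1 = (1 - t) + t * (1 - t ^+ m) by rewrite exprS; ring.
rewrite -natr1 mulrDl mul1r addrC lerD2r; apply: le_trans IHm.
by rewrite ler_piMl // subr_ge0 exprn_ile1.
Qed.

(** Replacing [a_k] by [1 / k] in [- k (- a_k)^(r+1)] gives [(- 1 / k)^r]; for [n = (r + 1) k] this
    is the present value over [n^r]. *)
Definition osc_coef (R : nzRingType) (r n : nat) : R := (r.+1 %| n)%N%:R * (- r.+1%:R) ^+ r.

Lemma periodic_osc_coef (R : nzRingType) r : periodic_seq (osc_coef R r).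
Proof. by exists r.+1 => // n; rewrite /osc_coef dvdn_addl. Qed.

(* In terms of [k = n / (r + 1)], the term [osc_coef r n / n^r] is [(- 1 / k)^r]. *)
Lemma osc_coef_sum (R : realFieldType) r n : (0 < r)%N -> (0 < n)%N ->
  osc_coef R r n / n%:R ^+ r = \sum_(1 <= k < n) (k * r.+1 == n)%N%:R * (- k%:R^-1) ^+ r.
Proof.
move=> r0 n0; rewrite /osc_coef.
have [/dvdnP[k nE]|nd] := boolP (r.+1 %| n)%N; last first.
  rewrite !mul0r big1 // => k _; case: eqP => [nE|_]; last by rewrite mul0r.
  by move: nd; rewrite -nE dvdn_mull.
have k0 : (0 < k)%N by move: n0; rewrite nE; case: (k).
have kn : k \in index_iota 1 n by rewrite mem_index_iota k0 nE; nia.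
rewrite (bigD1_seq k) ?iota_uniq //= big1 ?addr0 => [|i ik].
  rewrite nE eqxx !mul1r -exprVn -exprMn; congr (_ ^+ r).
  rewrite natrM invfM mulNr mulrCA divff ?mulr1 // pnatr_eq0 //.
by rewrite nE eqn_pmul2r // (negbTE ik) mul0r.
Qed.

(** Divisors [k] with [n / k > s + 1] are negligible by [sum_dvd_pow_le]. The others satisfy
    [k >= n / (s + 1)], so [k a_k] is close enough to 1 to replace the main term by
    [(- 1 / k)^(n/k - 1)]. *)
Lemma irr_ld_expansion (R : realFieldType) (F : finFieldType) s : exists C : R,
  bnd C s.+1 (fun n => irr_ld R F n - \sum_(1 <= r < s.+1) osc_coef R r n / n%:R ^+ r).
Proof.
have [C C0 CP] := sum_dvd_pow_le R s; have [D D0 DP] := natr_half_le R s.+2.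
have [E E0 EP] := natr_half_le R s.+1.
(* The first [s + 1] is the exponent lost in [onem_exp_le], [D] bounds the defect of [k a_k], and
   the power of [s + 1] converts powers of [k + 1] into powers of [n + 1]. *)
pose D1 : R := s.+1%:R * D * s.+1%:R ^+ s.+2.
have D10 : 0 <= D1 by apply: mulr_ge0; [exact: mulr_ge0|exact: exprn_ge0].
(* From [n = 2 (s + 1)] on, a divisor with cofactor at most [s + 1] is at least 2, hence not the
   exceptional index [k = 1]. *)
apply: (@bnd_near _ (C * 2 ^+ s.+1 + D1 + E) _ (2 * s.+1)) => [|n sn].
  by rewrite !addr_ge0 // mulr_ge0 ?exprn_ge0.
have n1 : (1 < n)%N by lia.
have n0 : (0 < n)%N by lia.
have -> : \sum_(1 <= r < s.+1) osc_coef R r n / n%:R ^+ r =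
    \sum_(1 <= k < n) \sum_(1 <= r < s.+1) (k * r.+1 == n)%N%:R * (- k%:R^-1) ^+ r.
  rewrite exchange_big /=; apply: eq_big_nat => r /andP[r0 _].
  exact: osc_coef_sum.
rewrite /irr_ld /irr_logders big_nat_recr //= irr_logder_diag // addr0 -sumrB.
(* For a given divisor [k], only [r = n / k - 1] contributes to the expansion. *)
have inner k : (0 < k < n)%N -> (k %| n)%N ->
    \sum_(1 <= r < s.+1) (k * r.+1 == n)%N%:R * (- k%:R^-1) ^+ r =
    if (s.+1 < n %/ k)%N then 0 else (- k%:R^-1) ^+ (n %/ k).-1 :> R.
  move=> /andP[k0 kn] dv; have nE : (n = (n %/ k) * k)%N by rewrite divnK.
  have m1 : (1 < n %/ k)%N.
    rewrite ltn_neqAle divn_gt0 // (ltnW kn) andbT eq_sym.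
    by apply: contraTneq kn => e; rewrite nE e mul1n ltnn.
  have kr r : (k * r.+1 == n)%N = (r == (n %/ k).-1).
    by rewrite {1}nE mulnC eqn_pmul2r // -{1}(prednK (ltnW m1)).
  case: ltnP => sm.
    rewrite big_nat big1 // => r /andP[_ rs].
    by rewrite kr ltn_eqF ?mul0r //; lia.
  rewrite (bigD1_seq (n %/ k).-1) ?iota_uniq //=; last first.
    by rewrite mem_index_iota; lia.
  rewrite kr eqxx mul1r big1 ?addr0 // => r /negbTE rk.
  by rewrite kr rk mul0r.
apply: le_trans (ler_norm_sum _ _ _) _.
apply: (@le_trans _ _ (\sum_(1 <= k < n)
   ((if [&& 1 < k, k %| n & s.+1 < n %/ k]%N then k%:R ^- (n %/ k).-1 else 0) +
    (D1 / n.+1%:R ^+ s.+2 + 2 ^- n./2)))).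
  rewrite big_nat [leRHS]big_nat; apply: ler_sum => k /andP[k0 kn].
  have e0 : 0 <= D1 / n.+1%:R ^+ s.+2 by rewrite divr_ge0 ?exprn_ge0.
  have [dv|ndv] := boolP (k %| n)%N; last first.
    rewrite /irr_logder (negbTE ndv) !andbF mul0r sub0r normrN.
    rewrite big1 ?normr0 ?add0r ?addr_ge0 ?invr_ge0 ?exprn_ge0 // => r _.
    case: eqP => [nE|_]; last by rewrite mul0r.
    by move: ndv; rewrite -nE dvdn_mulr.
  rewrite inner ?k0 //=; case: ltnP => sm.
    rewrite subr0 andbT; apply: le_trans (normr_irr_logder_le R F k0 kn dv) _.
    rewrite lerD ?lerDr //.
    by case: (1 < k)%N; rewrite ?mul1r ?mul0r.
  rewrite andbF add0r.
  have nE : (n = (n %/ k) * k)%N by rewrite divnK.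
  have k1 : (1 < k)%N by move: sm sn nE; move: (n %/ k)%N => m; nia.
  rewrite /irr_logder n0 dv (gtn_eqF k1) /= !mul1r addrAC.
  apply: le_trans (ler_normB _ _) _; rewrite lerD //; last first.
    rewrite ger0_norm ?mulr_ge0 ?invr_ge0 ?exprn_ge0 ?irr_density_ge0 //.
    apply: (@le_trans _ _ (1 * 2 ^- (n - k))).
      by rewrite ler_pM ?mulr_ge0 ?invr_ge0 ?exprn_ge0 ?irr_density_ge0
         ?natr_irr_density_le1 ?invX_card_le.
    by rewrite mul1r inv2X_half_le // dvdn_double_le.
  set a := irr_density R F k; have kp : 0 < k%:R :> R by rewrite ltr0n.
  have a0 : 0 <= a := irr_density_ge0 _ _ _.
  have t1 : 0 <= k%:R * a <= 1 by rewrite mulr_ge0 //= natr_irr_density_le1.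
  move: sm nE; case: (n %/ k)%N => [|m]; first by move=> _ nE; move: n0; rewrite nE mul0n.
  move=> sm nE; rewrite [m.+1.-1]/=.
  have -> : - (k%:R * (- a) ^+ m.+1) - (- k%:R^-1) ^+ m =
      - ((-1) ^+ m * k%:R^-1 ^+ m * (1 - (k%:R * a) ^+ m.+1)).
    rewrite [(- a) ^+ _]exprNn [(- k%:R^-1) ^+ _]exprNn [(k%:R * a) ^+ _]exprMn ![_ ^+ m.+1]exprS.
    have e : k%:R^-1 ^+ m * k%:R ^+ m = 1 :> R by rewrite -exprMn mulVf ?expr1n // gt_eqF.
    transitivity (k%:R * (a * a ^+ m) * (-1) ^+ m * (k%:R^-1 ^+ m * k%:R ^+ m) - (-1) ^+ m * k%:R^-1 ^+ m).
      by rewrite e; ring.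
    by ring.
  rewrite normrN normrM normrM normrX normrN1 expr1n mul1r.
  rewrite [`|_ ^+ m|]ger0_norm ?exprn_ge0 ?invr_ge0 //.
  rewrite [`|1 - _|]ger0_norm ?subr_ge0 ?exprn_ile1 ?mulr_ge0 ?natr_irr_density_le1 //.
  apply: (@le_trans _ _ (1 - (k%:R * a) ^+ m.+1)).
    rewrite ler_piMl ?subr_ge0 ?exprn_ile1 ?mulr_ge0 ?natr_irr_density_le1 //.
    by rewrite invf_le1 // ler1n.
  apply: le_trans (onem_exp_le _ t1) _.
  apply: (@le_trans _ _ (s.+1%:R * (D / k.+1%:R ^+ s.+2))).
    rewrite ler_pM ?subr_ge0 ?natr_irr_density_le1 ?ler_nat //.
    by apply: le_trans (irr_density_defect R F k0) (DP k).
  rewrite /D1 -[leRHS]mulrA -[leRHS]mulrA ler_wpM2l // ler_wpM2l // ler_pdivlMr ?exprn_gt0 //.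
  rewrite mulrC ler_pdivrMr ?exprn_gt0 // -exprMn lerXn2r ?nnegrE ?mulr_ge0 //.
  by rewrite -natrM ler_nat nE; nia.
rewrite big_split /= -big_mkcond.
apply: le_trans (lerD (CP n n0) (lexx _)) _.
rewrite sumr_const_nat -[X in _ + X <= _]mulr_natl mulrDr.
have h1 : C / n%:R ^+ s.+1 <= C * 2 ^+ s.+1 / n.+1%:R ^+ s.+1.
  rewrite -mulrA ler_wpM2l // -exprVn -[2 ^+ _ * _]mulrC -exprVn -exprMn.
  by rewrite lerXn2r ?nnegrE ?mulr_ge0 ?invr_ge0 // mulrC invr_nat_le.
have h2 : (n - 1)%:R * (D1 / n.+1%:R ^+ s.+2) <= D1 / n.+1%:R ^+ s.+1.
  rewrite mulrCA ler_wpM2l // exprS invfM mulrA ler_piMl ?invr_ge0 ?exprn_ge0 //.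
  by rewrite ler_pdivrMr // mul1r ler_nat; lia.
have h3 : (n - 1)%:R * 2 ^- n./2 <= E / n.+1%:R ^+ s.+1.
  by apply: le_trans (EP n); rewrite ler_wpM2r ?invr_ge0 ?exprn_ge0 // ler_nat leq_subr.
by rewrite !mulrDl addrA; apply: lerD => //; apply: lerD.
Qed.

(** The coefficients of [(1 + a_1 z) H(z)], which are the increments of the probability. *)
Definition prob_diff (R : numFieldType) (F : finFieldType) : nat -> R :=
  convol (fun n => (1 + irr_density R F 1 *: 'X^1)`_n) (irr_coef R F).

(** The logarithmic derivatives agree up to index [N]: by Gauss's formula the terms coming from
    [(1 - (z / q)^k)^(I_k)] sum to [- 1] at each index from 1 to [N], as for [1 - z]. *)
Lemma prob_prod_irr_prod (R : numFieldType) (F : finFieldType) N n : (n <= N)%N ->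
  ((1 + (-1) *: 'X^1) * \prod_(1 <= k < N.+1) (1 + irr_density R F k *: 'X^k))`_n =
  ((1 + irr_density R F 1 *: 'X^1) * irr_prod R F N)`_n.
Proof.
pose c k j := (((0 < j) && (k %| j))%N%:R * - (k%:R * (- irr_density R F k) ^+ (j %/ k))) : R.
have ldP : log_deriv (\prod_(1 <= k < N.+1) (1 + irr_density R F k *: 'X^k))
    (fun j => \sum_(1 <= k < N.+1) c k j).
  elim: N => [|N IHN].
    rewrite big_geq // (_ : (fun _ => _) = fun _ => 0); first exact: log_deriv1.
    by apply/funext => j; rewrite big_geq.
  rewrite big_nat_recr //=.
  rewrite (_ : (fun _ => _) = fun j => \sum_(1 <= k < N.+1) c k j + c N.+1 j).
    exact: log_derivM IHN (log_deriv_binomial _ _).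
  by apply/funext => j; rewrite big_nat_recr.
apply: (log_deriv_uniq (log_derivM (log_deriv_binomial (-1) (ltn0Sn 0)) ldP)
  (log_derivM (log_deriv_binomial (irr_density R F 1) (ltn0Sn 0)) (log_deriv_irr_prod R F N))).
- by rewrite mul0r add0r big1 // => k _; rewrite /c mul0r.
- by rewrite mul0r add0r irr_logders0.
- have fE (p : {poly R}) : p`_0 = p.[0] by rewrite horner_coef0.
  rewrite !fE !hornerM -!fE !coef0_binomial // irr_prod_coef0 !fE big_nat horner_prod big1 ?mulr1 //.
  by move=> k /andP[k0 _]; rewrite -fE coef0_binomial.
move=> j /andP[j0 jN]; rewrite j0 dvd1n divn1 !mul1r opprK expr1n.
have cE k : (0 < k)%N -> irr_logder R F k j = (k != 1%N)%:R * c k j -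
    ((k %| j)%N%:R * (k%:R * irr_density R F k * #|F|%:R ^- (j - k))).
  by move=> k0; rewrite /irr_logder /c j0 /= mulrBr; congr (_ - _); ring.
have -> : irr_logders R F N j = \sum_(1 <= k < N.+1) c k j - c 1%N j - 1.
  rewrite /irr_logders (eq_big_nat _ _ (F2 := fun k => (k != 1%N)%:R * c k j -
    ((k %| j)%N%:R * (k%:R * irr_density R F k * #|F|%:R ^- (j - k))))); last first.
    by move=> k /andP[k0 _]; apply: cE.
  rewrite sumrB; congr (_ - _).
    have N0 : (1 < N.+1)%N by rewrite ltnS (leq_trans j0).
    rewrite big_ltn // [in RHS]big_ltn // (_ : (1 != 1)%N%:R = 0 :> R) // mul0r add0r addrAC subrr add0r.
    by apply: eq_big_nat => k /andP[k1 _]; rewrite gtn_eqF // mul1r.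
  rewrite -[RHS](sum_irr_density R F j0) (big_cat_nat (n := j.+1)) //=.
  rewrite [X in _ + X](_ : _ = 0) ?addr0; last first.
    by rewrite big_nat big1 // => k /andP[jk _]; rewrite gtnNdvd // mul0r.
  by rewrite [RHS]big_mkcond; apply: eq_bigr => k _; case: ifP; rewrite ?mul1r ?mul0r.
have -> : c 1%N j = - (- irr_density R F 1) ^+ j by rewrite /c j0 dvd1n divn1 !mul1r.
by ring.
Qed.

Lemma prob_psum (R : numFieldType) (F : finFieldType) n :
  (num_distinct_degree F n)%:R / #|F|%:R ^+ n = psum (prob_diff R F) n.+1.
Proof.
rewrite prob_coef; set P := \prod_(1 <= k < n.+1) _.
have gE j : (j <= n)%N -> prob_diff R F j = ((1 + (-1) *: 'X^1) * P)`_j.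
  move=> jn; rewrite prob_prod_irr_prod // -[RHS](congr1 (fun f => f j) (convol_coef _ _)).
  rewrite /prob_diff convolC [in RHS]convolC.
  by apply: eq_convol_l => i ij; rewrite irr_prod_stable // (leq_trans ij).
have PE j : ((1 + (-1) *: 'X^1) * P)`_j = P`_j - (if j is i.+1 then P`_i else 0).
  rewrite mulrDl mul1r coefD -scalerAl coefZ coefXnM mulN1r.
  by case: j => [|j]; rewrite ?subn1.
suff h m : (m <= n)%N -> psum (prob_diff R F) m.+1 = P`_m by rewrite h.
elim: m => [|m IHm] mn; first by rewrite /psum big_ord1 gE // PE subr0.
by rewrite /psum big_ord_recr /= -/(psum _ _) IHm ?(ltnW mn) // gE // PE addrC subrK.
Qed.

Lemma prob_diffE (R : numFieldType) (F : finFieldType) n :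
  psum (prob_diff R F) n.+1 =
  psum (irr_coef R F) n.+1 + irr_density R F 1 * psum (irr_coef R F) n.
Proof.
have gE j : prob_diff R F j = irr_coef R F j +
    irr_density R F 1 * (if j is i.+1 then irr_coef R F i else 0).
  have <- : ((1 + irr_density R F 1 *: 'X^1) * \poly_(i < j.+1) irr_coef R F i)`_j = prob_diff R F j.
    rewrite -[LHS](congr1 (fun f => f j) (convol_coef _ _)) /prob_diff convolC [in RHS]convolC.
    apply: eq_convol_l => i ij.
    by rewrite coef_poly ltnS ij.
  rewrite mulrDl mul1r coefD -scalerAl coefZ coefXnM coef_poly ltnSn.
  by case: j => [|j] //=; rewrite subn1 coef_poly ltnS leqnSn.
rewrite /psum (eq_bigr _ (fun (k : 'I_n.+1) _ => gE k)) big_split /=; congr (_ + _).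
by rewrite -big_distrr /= big_ord_recl add0r.
Qed.

Lemma delta_partial_horner (R : realType) (F : finFieldType) N : (0 < N)%N ->
  delta_partial R F N = (1 + irr_density R F 1) * (irr_prod R F N).[1].
Proof.
move=> N0; rewrite /delta_partial /irr_prod horner_prod big_ltn // [in RHS]big_ltn //.
have hE (b : R) k : (1 + b *: 'X^k).[1] = 1 + b.
  by rewrite !hornerE expr1n mulr1.
rewrite /irr_factor eqxx mul1r horner_exp hE mulrA; congr (_ * _ * _).
apply: eq_big_nat => k /andP[k1 _]; rewrite (gtn_eqF k1) hornerM horner_exp !hE //.
Qed.

Lemma bnd_irr_coef (R : realType) (F : finFieldType) : exists K : R, bnd K 2 (irr_coef R F).
Proof. by have [K KP] := bnd_irr_prod R F; exists K => n; apply: KP. Qed.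

Lemma bnd_err (R : rcfType) (K : R) s y : bnd K s.+1 y -> err s y.
Proof.
move=> yK; exists K => [|n]; first exact: bnd_ge0 yK.
apply: le_trans (yK n) _; rewrite ler_wpM2l ?(bnd_ge0 yK) //.
rewrite lef_pV2 ?posrE ?mulr_gt0 ?exprn_gt0 ?sqrtS_gt0 //.
by rewrite exprSr ler_wpM2l ?exprn_ge0 // sqrtS_le.
Qed.

Lemma cvg_inv_sqrtS (R : realType) (C : R) :
  (fun n => C * (Num.sqrt n.+1%:R)^-1) @ \oo --> (0 : R).
Proof.
rewrite -(mulr0 C); apply: cvgM; first exact: cvg_cst.
have h := continuous_cvg _ (@sqrt_continuous R 0) (@cvg_harmonic R).
rewrite sqrtr0 in h.
have -> : (fun n => (Num.sqrt n.+1%:R)^-1) = Num.sqrt \o harmonic :> (nat -> R).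
  by apply/funext => n; rewrite /harmonic /= sqrtrV.
exact: h.
Qed.

(** Exchange of the truncation limit with evaluation at 1: [irr_prod R F N] and [H] share their
    coefficients up to [N], and the remaining ones are a tail of [K w32] with [K] independent of
    [N]. *)
Lemma cvg_delta_partial (R : realType) (F : finFieldType) (l : R) :
  psum (irr_coef R F) @ \oo --> l ->
  delta_partial R F @ \oo --> (1 + irr_density R F 1) * l.
Proof.
move=> hl; have [K KP] := bnd_irr_prod R F; have K0 := bnd_ge0 (KP 0%N).
have tail N : `|(irr_prod R F N).[1] - psum (irr_coef R F) N.+1| <= 4 * K / Num.sqrt N.+1%:R.
  set p := irr_prod R F N; pose M := maxn N.+1 (size p).
  have -> : p.[1] = \sum_(0 <= j < M) p`_j.
    rewrite (horner_coef_wide _ (leq_maxr N.+1 (size p))) big_mkord.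
    by apply: eq_bigr => j _; rewrite expr1n mulr1.
  rewrite /psum -(big_mkord predT (irr_coef R F)).
  rewrite (big_cat_nat (n := N.+1)) ?leq_maxl //=.
  rewrite (eq_big_nat _ _ (F2 := irr_coef R F)) => [|j /andP[_ jN]]; last exact: irr_prod_stable.
  rewrite addrAC subrr add0r; apply: le_trans (ler_norm_sum _ _ _) _.
  apply: (@le_trans _ _ (\sum_(N.+1 <= j < M) K * w32 R j)).
    by apply: ler_sum => j _; apply: bnd_w32 (KP N).
  rewrite -big_distrr /= [4 * K]mulrC -mulrA ler_wpM2l //.
  apply: le_trans (sum_w32_tail _ _ _) _; rewrite ler_wpM2l //.
  by rewrite lef_pV2 ?posrE ?sqrtS_gt0 // ler_wsqrtr // ler_nat.
have c1 : (fun N => (irr_prod R F N).[1]) @ \oo --> l.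
  have h : (fun N => (irr_prod R F N).[1] - psum (irr_coef R F) N.+1) @ \oo --> (0 : R).
    apply/norm_cvg0P.
    have near_tail : \forall N \near \oo, 0 <=
        `|(irr_prod R F N).[1] - psum (irr_coef R F) N.+1| <= 4 * K / Num.sqrt N.+1%:R.
      by near=> N; rewrite normr_ge0 tail.
    apply: (squeeze_cvgr near_tail); [exact: cvg_cst|exact: cvg_inv_sqrtS].
  have h2 : (fun N => psum (irr_coef R F) N.+1) @ \oo --> l by rewrite cvg_shiftS.
  have -> : (fun N => (irr_prod R F N).[1]) = (fun N => (irr_prod R F N).[1] -
      psum (irr_coef R F) N.+1) + (fun N => psum (irr_coef R F) N.+1).
    by apply/funext => N; rewrite fctE subrK.
  by rewrite -[l]add0r; apply: cvgD.
rewrite -cvg_shiftS; rewrite -cvg_shiftS in c1.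
have -> : (fun N => delta_partial R F N.+1) =
    (fun N => (1 + irr_density R F 1) * (irr_prod R F N.+1).[1]).
  by apply/funext => N; rewrite delta_partial_horner.
by apply: cvgM c1; apply: cvg_cst.
Unshelve. all: by end_near. Qed.

(** * The bootstrap *)

Definition invpow (R : fieldType) (p : nat -> R) (r n : nat) : R := p n / n%:R ^+ r.

(* The convolutions [x_1 * ... * x_m * e * h] with [e = O(n^(-k))]; [nder_span] collects
   the sequences that arise when they are multiplied by [n]. *)
Inductive fam (R : numFieldType) (h : nat -> R) (k : nat) : nat -> (nat -> R) -> Prop :=
| fam_base e C : bnd C k e -> fam h k 0 (convol e h)
| fam_convol m p r y : periodic_seq p -> (0 < r)%N -> fam h k m y ->
    fam h k m.+1 (convol (invpow p r) y).

Inductive nder_span (R : numFieldType) (h : nat -> R) (k m : nat) : (nat -> R) -> Prop :=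
| span_fam m' y : fam h k m' y -> nder_span h k m y
| span_periodic m' p y : (m' < m)%N -> periodic_seq p -> fam h k.+1 m' y ->
    nder_span h k m (convol (fun n => (0 < n)%N%:R * p n) y)
| spanD y z : nder_span h k m y -> nder_span h k m z ->
    nder_span h k m (fun n => y n + z n).

Lemma bnd_weak (R : numFieldType) (C : R) s s' y : (s <= s')%N -> bnd C s' y -> bnd C s y.
Proof.
move=> ss yC n; apply: le_trans (yC n) _; rewrite ler_wpM2l ?(bnd_ge0 yC) //.
by rewrite lef_pV2 ?posrE ?exprn_gt0 // ler_weXn2l // ler1n.
Qed.

Lemma bnd_nder (R : numFieldType) (C : R) s y : bnd C s.+1 y -> bnd C s (nder y).
Proof.
move=> yC n; rewrite /nder normrM normr_nat; have C0 := bnd_ge0 yC.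
apply: (@le_trans _ _ (n.+1%:R * (C / n.+1%:R ^+ s.+1))).
  by rewrite ler_pM ?ler_nat.
by rewrite exprS invfM mulrCA mulVKf.
Qed.

Lemma fam_weak (R : numFieldType) (h : nat -> R) k k' m y : (k <= k')%N ->
  fam h k' m y -> fam h k m y.
Proof.
move=> kk; elim=> [e C eC|m' p r z pp r0 _ IHz]; last exact: fam_convol.
exact/fam_base/(bnd_weak kk).
Qed.

Lemma span_sum (R : numFieldType) (h : nat -> R) k m (s : seq nat) (y : nat -> nat -> R) :
  (forall i, i \in s -> nder_span h k m (y i)) -> (0 < size s)%N ->
  nder_span h k m (fun n => \sum_(i <- s) y i n).
Proof.
elim: s => // i [|j s] IHs ys _.
  rewrite (_ : (fun _ => _) = y i); last by apply/funext => n; rewrite big_seq1.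
  by apply: ys; rewrite mem_seq1.
rewrite (_ : (fun _ => _) = fun n => y i n + \sum_(l <- j :: s) y l n); last first.
  by apply/funext => n; rewrite big_cons.
apply: spanD; first by apply: ys; rewrite mem_head.
by apply: IHs => // l ls; apply: ys; rewrite inE ls orbT.
Qed.

Lemma span_convol (R : numFieldType) (h : nat -> R) k m p r y : periodic_seq p -> (0 < r)%N ->
  nder_span h k m y -> nder_span h k m.+1 (convol (invpow p r) y).
Proof.
move=> pp r0; elim=> [m' z fz|m' p' z mm pp' fz|u v _ au _ av].
- exact/span_fam/fam_convol/fz.
- rewrite convolCA; apply: (@span_periodic _ _ _ _ m'.+1) => //.
  exact: fam_convol.
- by rewrite convolDr; apply: spanD.
Qed.

(** By Leibniz' rule, [e] loses one order of decay, [h] brings in [c] and hence one more factor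
    [p_r / n^r], and [p / n^r] becomes [p / n^(r-1)]. When [r = 1] this factor turns purely
    periodic: the remaining family has fewer factors while [e] keeps the decay [k + 1]. *)
Lemma nder_fam (R : rcfType) (h c : nat -> R) (p : nat -> nat -> R) k m y : (1 < k)%N ->
  nder h = convol c h -> (forall r, periodic_seq (p r)) ->
  (exists C, bnd C k (fun n => c n - \sum_(1 <= r < k) invpow (p r) r n)) ->
  fam h k.+1 m y -> nder_span h k m (nder y).
Proof.
move=> k1 hc pp [C cC]; elim=> [e D eD|m' p' r z pp' r0 fz IHz].
- rewrite nder_conv; apply: spanD.
    by apply/span_fam/fam_base/(bnd_nder eD).
  have eD' := bnd_weak (leqnSn k) eD.
  rewrite hc; set x := fun n => c n - _ in cC.
  have -> : c = fun n => x n + \sum_(1 <= r < k) invpow (p r) r n.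
    by apply/funext => n; rewrite /x subrK.
  rewrite convolDl convolDr; apply: spanD.
    by rewrite convolA; apply/span_fam/fam_base/(convol_bnd k1 eD' cC).
  rewrite convolCA convol_suml; apply: span_sum.
    move=> r; rewrite mem_index_iota => /andP[r0 _].
    by apply/span_fam/fam_convol; [exact: pp|exact: r0|exact: fam_base eD'].
  by rewrite size_iota subn_gt0.
- rewrite nder_conv; apply: spanD; last exact: span_convol.
  case: r r0 => [|[|r]] // _.
    rewrite (_ : nder _ = fun n => (0 < n)%N%:R * p' n).
      exact: span_periodic fz.
    apply/funext => -[|n]; rewrite /nder /invpow ?mul0r // expr1 mul1r.
    by rewrite mulrC divfK.
  rewrite (_ : nder _ = invpow p' r.+1); first exact/span_fam/fam_convol/(fam_weak (leqnSn k) fz).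
  apply/funext => -[|n]; rewrite /nder /invpow; first by rewrite mul0r exprS mul0r invr0 mulr0.
  by rewrite [in LHS]exprS invfM mulrCA mulVKf.
Qed.

Lemma fam_ell (R : realType) (h : nat -> R) K m y : bnd K 1 h -> fam h 2 m y ->
  exists C, forall n, `|y n| <= C * ell R n ^+ m.+1 / n.+1%:R.
Proof.
move=> hK; elim=> [e C eC|m' p r z pp r0 _ [C zC]].
  exists (C * K * 2); apply: convol_ell; first exact: bnd_weak eC.
  by move=> n; rewrite expr0 mulr1; apply: hK.
have [B B0 pB] := periodic_bounded pp.
exists (B * 2 * C * 2); apply: convol_ell => // n.
rewrite /invpow normrM -mulrA ler_pM //.
rewrite expr1 normfV normrX normr_nat; apply: le_trans (invr_nat_le _ _).
case: n => [|n]; first by rewrite expr0n gtn_eqF //.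
by rewrite lef_pV2 ?posrE ?exprn_gt0 // -{1}[n.+1%:R]expr1 ler_weXn2l // ler1n.
Qed.

(* The base case loses half an order to absorb the logarithms of the iterated
   convolutions; each step recovers one order from [y = (nder y) / n]. *)
Lemma fam_asy (R : realType) (h c : nat -> R) (p : nat -> nat -> R) K :
  nder h = convol c h -> (forall r, periodic_seq (p r)) -> bnd K 1 h ->
  (forall s, exists C, bnd C s.+1 (fun n => c n - \sum_(1 <= r < s.+1) invpow (p r) r n)) ->
  forall s m y, fam h s.+2 m y -> asy s 1 y.
Proof.
move=> hc pp hK cE; elim=> [|s IHs] m y.
  move=> /(fam_ell hK)[C yC]; have [D D0 DP] := ell_exp_le R m.+1.
  have C0 : 0 <= C.
    have := le_trans (normr_ge0 _) (yC 0%N).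
    by rewrite /ell ln1 addr0 expr1n mulr1 divr1.
  apply: asy_err; exists (C * D) => [|n]; first exact: mulr_ge0.
  apply: le_trans (yC n) _; rewrite -!mulrA ler_wpM2l //.
  rewrite /errw expr0 mul1r ler_pdivrMr // mulrAC -mulrA.
  apply: le_trans (DP n) _; rewrite ler_wpM2l //.
  by rewrite -{2}(sqr_sqrtS R n) expr2 mulrK // unitfE gt_eqF // sqrtS_gt0.
(* The periodic convolutions require the order being proved, but for fewer factors, whence the inner
   induction on [m]. *)
elim/ltn_ind: m y => m IHm y fy; apply: asy_div_iff.
have := nder_fam (isT : 1 < s.+2)%N hc pp (cE s.+1) fy.
elim=> [m' z /IHs az|m' p' z mm pp' fz|u v _ au _ av].
- exact: asy_weak az.
- by apply: asy_convol_periodic => //; apply: IHm fz.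
- exact: asyD.
Qed.

(** * Uniqueness of the coefficients and conclusion *)

Lemma common_period (T : Type) (c : nat -> nat -> T) d : (forall j, periodic_seq (c j)) ->
  exists2 t, (0 < t)%N & forall j, (j < d)%N -> forall m n, c j (n + m * t)%N = c j n.
Proof.
move=> pc; elim: d => [|d [t t0 ct]]; first by exists 1%N.
have [u u0 cu] := pc d; exists (t * u)%N => [|j]; first by rewrite muln_gt0 t0.
rewrite ltnS leq_eqVlt => /orP[/eqP ->|jd] m n.
  by rewrite mulnA (periodic_seqM cu).
by rewrite [(t * u)%N]mulnC mulnA ct.
Qed.

(** Dividing by [x k] shows that the polynomial with shifted coefficients also tends to 0; by
    induction it vanishes, and the constant coefficient is then the limit. *)
Lemma cvg_poly_eq0 (R : realType) d (b x : nat -> R) : x @ \oo --> +oo ->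
  (fun k => \sum_(j < d) b j * x k ^+ j) @ \oo --> (0 : R) ->
  forall j, (j < d)%N -> b j = 0.
Proof.
move=> xoo; have xpos : \forall k \near \oo, 0 < x k by move/cvgryPgt : xoo; apply.
have xV : (fun k => (x k)^-1) @ \oo --> (0 : R) by apply/gtr0_cvgV0.
elim: d b => // d IHd b b0.
pose S k := \sum_(j < d.+1) b j * x k ^+ j; pose U k := \sum_(j < d) b j.+1 * x k ^+ j.
have SE k : S k = b 0%N + x k * U k.
  rewrite /S /U big_ord_recl expr0 mulr1 mulr_sumr; congr (_ + _).
  by apply: eq_bigr => j _; rewrite lift0 exprS; ring.
have U0 : U @ \oo --> (0 : R).
  have h : (fun k => (S k - b 0%N) * (x k)^-1) @ \oo --> (0 : R).
    rewrite -(mulr0 (0 - b 0%N)); apply: cvgM xV; apply: cvgB b0 _; exact: cvg_cst.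
  apply: cvg_trans h; apply: near_eq_cvg; near=> k.
  have xk : x k != 0 by rewrite gt_eqF //; near: k.
  by rewrite SE addrAC subrr add0r mulrC mulKf.
have bS := IHd (fun j => b j.+1) U0.
have S0 : S = fun _ => b 0%N.
  apply/funext => k; rewrite SE /U big1 ?mulr0 ?addr0 // => j _.
  by rewrite bS // mul0r.
move=> [_|j jd]; last exact: bS.
have b1 : S @ \oo --> b 0%N by rewrite S0; exact: cvg_cst.
exact: (cvg_unique _ b1 b0).
Unshelve. all: by end_near. Qed.

Lemma ln_nat_cvgy (R : realType) n t : (0 < t)%N ->
  (fun k => ln (n + k * t)%:R : R) @ \oo --> +oo.
Proof.
move=> t0; apply/cvgryPge => A; near=> k.
rewrite -[A]expRK ler_ln ?posrE ?expR_gt0 //.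
  apply: (@le_trans _ _ (Num.bound (expR A))%:R).
    by apply/ltW/archi_boundP/expR_ge0.
  rewrite ler_nat (@leq_trans k) //; first by near: k; exists (Num.bound (expR A)).
  by rewrite (leq_trans (leq_pmulr k t0)) ?leq_addl.
rewrite ltr0n addn_gt0 muln_gt0 t0 andbT orbC; apply/orP; left.
by near: k; exists 1%N.
Unshelve. all: by end_near. Qed.

(** Along [n + k t], with [t] a common period, the coefficients are frozen and [Q] is a polynomial
    in [ln (n + k t)] that tends to 0. *)
Lemma oscillating_log_poly_eq0 (R : realType) (Q : nat -> R) :
  oscillating_log_poly Q -> err 0 Q -> forall n, (0 < n)%N -> Q n = 0.
Proof.
move=> [d [c [pc QE]]] [C C0 QC] n n0.
have [t t0 ct] := common_period d pc.
rewrite QE big1 // => j _.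
rewrite (@cvg_poly_eq0 R d (fun j => c j n) _ (@ln_nat_cvgy R n t t0) _ j) ?mul0r //.
have QS k : \sum_(j < d) c j n * ln (n + k * t)%:R ^+ j = Q (n + k * t)%N.
  by rewrite QE; apply: eq_bigr => i _; rewrite ct.
have near_tail : \forall k \near \oo, 0 <= `|\sum_(j < d) c j n * ln (n + k * t)%:R ^+ j| <=
    C * (Num.sqrt k.+1%:R)^-1.
  near=> k; rewrite normr_ge0 QS /=; apply: le_trans (QC _) _; rewrite ler_wpM2l //.
  rewrite /errw expr0 mul1r lef_pV2 ?posrE ?sqrtS_gt0 // ler_wsqrtr // ler_nat ltnS.
  by rewrite (leq_trans (leq_pmulr k t0)) ?leq_addl.
by apply/norm_cvg0P; apply: (squeeze_cvgr near_tail); [exact: cvg_cst|exact: cvg_inv_sqrtS].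
Unshelve. all: by end_near. Qed.

Lemma oscillating_log_polyD (R : realType) (P Q : nat -> R) :
  oscillating_log_poly P -> oscillating_log_poly Q ->
  oscillating_log_poly (fun n => P n + Q n).
Proof.
move=> [d [c [pc PE]]] [d' [c' [pc' QE]]].
pose b j n : R := (j < d)%N%:R * c j n + (j < d')%N%:R * c' j n.
exists (d + d')%N, b; split=> [j|n].
  apply: (@periodic_comp2 _ _ _ (fun x y => (j < d)%N%:R * x + (j < d')%N%:R * y)) => //.
have ext m (a : nat -> nat -> R) : (m <= d + d')%N -> \sum_(j < m) a j n * ln n%:R ^+ j =
    \sum_(j < d + d') (j < m)%N%:R * a j n * ln n%:R ^+ j.
  move=> md; rewrite (big_ord_widen _ (fun j => a j n * ln n%:R ^+ j) md) big_mkcond.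
  by apply: eq_bigr => j _; case: ltnP; rewrite ?mul1r // !mul0r.
rewrite PE QE (ext d) ?leq_addr // (ext d') ?leq_addl // -big_split.
by apply: eq_bigr => j _; rewrite /b mulrDl.
Qed.

Lemma oscillating_log_poly_term (R : realType) (c : nat -> R) j : periodic_seq c ->
  oscillating_log_poly (fun n => c n * ln n%:R ^+ j).
Proof.
move=> pc; exists j.+1, (fun i n => (i == j)%:R * c n); split=> [i|n].
  exact: (@periodic_comp _ _ (fun x => (i == j)%:R * x)).
rewrite big_ord_recr /= eqxx mul1r big1 ?add0r // => i _.
by rewrite (ltn_eqF (ltn_ord i)) !mul0r.
Qed.

Lemma oscillating_log_poly0 (R : realType) : oscillating_log_poly (fun _ : nat => 0 : R).
Proof.
exists 0%N, (fun _ _ => 0); split=> [_|n]; last by rewrite big_ord0.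
exact: periodic_const.
Qed.

Lemma oscillating_log_polyN (R : realType) (P : nat -> R) :
  oscillating_log_poly P -> oscillating_log_poly (fun n => - P n).
Proof.
move=> [d [c [pc PE]]]; exists d, (fun j n => - c j n); split=> [j|n].
  exact: periodic_comp.
by rewrite PE -sumrN; apply: eq_bigr => j _; rewrite mulNr.
Qed.

Lemma asy_coefs (R : realType) s (y : nat -> R) : asy s 0 y ->
  exists2 P : nat -> nat -> R, (forall l, oscillating_log_poly (P l)) &
    err s (fun n => y n - \sum_(l < s.+1) P l n / n%:R ^+ l).
Proof.
elim=> [c j l pc _|z ez|u v _ [P oP eP] _ [Q oQ eQ]].
- have [ls|sl] := leqP l s; last first.
    exists (fun _ _ => 0) => [_|]; first exact: oscillating_log_poly0.
    apply: err_le (err_logpow j pc sl) => n.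
    by rewrite big1 ?subr0 // => i _; rewrite mul0r.
  exists (fun i n => (i == l)%:R * (c n * ln n%:R ^+ j)) => [i|].
    case: (i == l); first by have := oscillating_log_poly_term j pc; congr oscillating_log_poly; apply/funext => n; rewrite mul1r.
    by have := oscillating_log_poly0 R; congr oscillating_log_poly; apply/funext => n; rewrite mul0r.
  apply: (@err_fin _ _ _ 0) => n _; rewrite (bigD1 (Ordinal (ls : (l < s.+1)%N))) //= eqxx mul1r.
  rewrite big1 ?addr0 ?subrr // => i il; rewrite (negbTE (_ : (i : nat) != l)) ?mul0r //.
- exists (fun _ _ => 0) => [_|]; first exact: oscillating_log_poly0.
  apply: err_le ez => n; rewrite big1 ?subr0 // => i _; exact: mul0r.
- exists (fun l n => P l n + Q l n) => [l|]; first exact: oscillating_log_polyD.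
  apply: err_le (errD eP eQ) => n; rewrite le_eqVlt; apply/orP; left; apply/eqP; congr `|_|.
  rewrite (eq_bigr _ (fun (l : 'I_s.+1) _ => mulrDl (P l n) (Q l n) _)) big_split /=.
  by rewrite opprD addrACA.
Qed.

Lemma asy_oscillating (R : realType) s r l (Q : nat -> R) : (r <= l)%N ->
  oscillating_log_poly Q -> asy s r (fun n => Q n / n%:R ^+ l).
Proof.
move=> rl [d [c [pc QE]]].
have h := @asy_sum R s r _ (index_enum 'I_d)
  (fun j n => c j n * ln n%:R ^+ j / n%:R ^+ l) (fun j => asy_term s j (pc j) rl).
by apply: eq_asy h => n; rewrite QE mulr_suml.
Qed.

(** All terms but the first decay, so the leading coefficient tends to 0 and vanishes for [n > 0];
    multiplying by [n] then shifts the expansion by one order. *)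
Lemma asy_coefs_uniq (R : realType) s (Q : nat -> nat -> R) :
  (forall l, oscillating_log_poly (Q l)) ->
  err s (fun n => \sum_(l < s.+1) Q l n / n%:R ^+ l) ->
  forall l n, (l <= s)%N -> (0 < n)%N -> Q l n = 0.
Proof.
elim: s Q => [|s IHs] Q oQ eQ.
  move=> l n; rewrite leqn0 => /eqP -> n0; apply: oscillating_log_poly_eq0 n0 => //.
  by apply: err_le eQ => m; rewrite big_ord1 expr0 divr1.
have e0 : err 0 (Q 0%N).
  have a1 : asy 0 1 (fun n => \sum_(l < s.+1) Q l.+1 n / n%:R ^+ l.+1).
    by apply: asy_sum => l; apply: asy_oscillating.
  have e1 := asy_errE a1.
  apply: err_le (asy_errE (asyB (asy_err 1 (err_weak (leq0n _) eQ)) (asy_err 1 e1))) => n.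
  rewrite big_ord_recl expr0 divr1 -addrA.
  under [X in _ + (X - _)]eq_bigr do rewrite lift0.
  by rewrite subrr addr0.
have Q0 := oscillating_log_poly_eq0 (oQ 0%N) e0.
move=> [|l] n ls n0; first exact: Q0.
apply: (IHs (fun l => Q l.+1)) => //.
have [C C0 QC] := eQ.
pose T n := \sum_(l < s.+1) Q l.+1 n / n%:R ^+ l.
exists (C + `|T 0%N|) => [|m]; first exact: addr_ge0.
case: m => [|m].
  rewrite /errw expr1n sqrtr1 mulr1 invr1 mulr1 -/(T 0%N) lerDr //.
have -> : \sum_(l < s.+1) Q l.+1 m.+1 / m.+1%:R ^+ l =
    m.+1%:R * \sum_(l < s.+2) Q l m.+1 / m.+1%:R ^+ l.
  rewrite [in RHS]big_ord_recl Q0 // mul0r add0r mulr_sumr; apply: eq_bigr => i _.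
  by rewrite lift0 exprS invfM mulrCA mulVKf.
rewrite normrM normr_nat; apply: le_trans (_ : m.+2%:R * (C * errw R s.+1 m.+1) <= _).
  by rewrite ler_pM ?ler_nat.
rewrite errwS mulrCA [_ * (_ / _)]mulrCA divff ?pnatr_eq0 // mulr1.
by rewrite ler_wpM2r ?(ltW (errw_gt0 _ _ _)) // lerDl.
Qed.

Lemma asy_full_expansion (R : realType) (y : nat -> R) :
  (forall s, asy s 0 y) -> full_oscillating_expansion y.
Proof.
move=> ay.
have [P PP] := choice (fun s => let: ex_intro2 P oP eP := asy_coefs (ay s) in
  ex_intro (fun P : nat -> nat -> R => (forall l, oscillating_log_poly (P l)) /\
    err s (fun n => y n - \sum_(l < s.+1) P l n / n%:R ^+ l)) P (conj oP eP)).
have oP s l : oscillating_log_poly (P s l) by case: (PP s).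
have eP s : err s (fun n => y n - \sum_(l < s.+1) P s l n / n%:R ^+ l) by case: (PP s).
(* Coefficients chosen for different truncation orders agree, so the diagonal [P r r] serves all
   orders at once. *)
have stable r s n : (r <= s)%N -> (0 < n)%N -> P s r n = P r r n.
  move=> rs n0; apply/eqP; rewrite -subr_eq0; apply/eqP.
  apply: (@asy_coefs_uniq R r (fun l n => P s l n - P r l n)) => //.
    by move=> l; apply: oscillating_log_polyD => //; apply: oscillating_log_polyN.
  have a1 : asy r r.+1 (fun n => \sum_(r.+1 <= l < s.+1) P s l n / n%:R ^+ l).
    rewrite (_ : (fun _ => _) = fun n => \sum_(i < s - r) P s (i + r.+1)%N n / n%:R ^+ (i + r.+1)).
      by apply: asy_sum => l; apply: asy_oscillating => //; rewrite leq_addl.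
    by apply/funext => m; rewrite -{1}[r.+1]add0n big_addn subSS big_mkord.
  have h := asyB (asyB (asy_err r.+1 (eP r)) (asy_err r.+1 (err_weak rs (eP s)))) a1.
  apply: err_le (asy_errE h) => m; rewrite le_eqVlt; apply/orP; left; apply/eqP; congr `|_|.
  rewrite -!(big_mkord predT (fun l => P s l m / m%:R ^+ l)).
  rewrite (big_cat_nat (n := r.+1) (p := s.+1)) //= !big_mkord.
  rewrite (eq_bigr _ (fun (l : 'I_r.+1) _ => mulrBl (m%:R ^- l) (P s l m) (P r l m))) sumrB.
  by move: (\sum_(_ < _) _) (\sum_(_ < _) _) (\sum_(_ <= _ < _) _) => a b d; ring.
exists (fun r => r%:R), (fun r => P r r); split => //.
- by move=> r s rs; rewrite ltr_nat.
- exact: cvgr_idn.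
move=> m; apply/eqoP => eps eps0; have [C C0 mC] := eP m.
near=> n.
have n0 : (0 < n)%N by near: n; exists 1%N.
have pE r : n%:R `^ r%:R = n%:R ^+ r :> R by rewrite powR_mulrn.
rewrite powRN pE.
rewrite (eq_bigr (fun r : 'I_m.+1 => P m r n / n%:R ^+ r)); last first.
  by move=> r _; rewrite pE stable // -ltnS.
apply: le_trans (mC n) _.
rewrite ger0_norm ?invr_ge0 ?exprn_ge0 // ler_pdivlMr ?exprn_gt0 ?ltr0n //.
(* The spare half power of [errw] turns the bound into a little-o. *)
apply: (@le_trans _ _ (C * (Num.sqrt n.+1%:R)^-1)).
  rewrite /errw invfM -!mulrA ler_wpM2l // mulrC -mulrA ler_piMr ?invr_ge0 ?sqrtr_ge0 //.
  by rewrite ler_pdivrMr ?exprn_gt0 // mul1r lerXn2r ?nnegrE // ler_nat.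
near: n; have h := cvg_inv_sqrtS C.
by move/cvgr0Pnorm_le : h => /(_ _ eps0); apply: filterS => n; apply: le_trans; exact: ler_norm.
Unshelve. all: by end_near. Qed.

(** The constant comes from [1 / (k + 1)^2 <= 2 (1 / (k + 1) - 1 / (k + 2))], which telescopes. *)
Lemma bnd_psum_tail (R : realFieldType) (K : R) (y : nat -> R) m n : bnd K 2 y -> (m <= n)%N ->
  `|psum y n - psum y m| <= 2 * K / m.+1%:R.
Proof.
move=> yK mn; have K0 := bnd_ge0 yK.
rewrite psum_sub //; apply: le_trans (ler_norm_sum _ _ _) _.
apply: (@le_trans _ _ (\sum_(m <= k < n) 2 * K * (k.+1%:R^-1 - k.+2%:R^-1))).
  apply: ler_sum => k _; apply: le_trans (yK k) _.
  have -> : k.+1%:R^-1 - k.+2%:R^-1 = (k.+1%:R * k.+2%:R)^-1 :> R.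
    by rewrite -[k.+2%:R]natr1; field; rewrite nat1r pnatr_eq0 natr1 pnatr_eq0.
  rewrite [2 * K]mulrC -mulrA ler_wpM2l // -[2]invrK -invfM.
  rewrite lef_pV2 ?posrE ?mulr_gt0 ?exprn_gt0 // mulrC ler_pdivrMr //.
  by rewrite expr2 -mulrA ler_wpM2l // -natrM ler_nat; lia.
rewrite -mulr_sumr ler_wpM2l ?mulr_ge0 //.
under eq_bigr do rewrite -opprB.
by rewrite sumrN telescope_sumr // opprB gerBl invr_ge0.
Qed.

Lemma bnd_binomial_coef (R : realFieldType) (b : R) k s : exists C : R,
  bnd C s (fun n => (1 + b *: 'X^k)`_n).
Proof.
apply: (@bnd_near _ 0 _ k.+1) => // n kn.
rewrite coefD coef1 coefZ coefXn !gtn_eqF ?(leq_trans _ kn) //.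
by rewrite mulr0 addr0 normr0 mul0r.
Qed.

Theorem proposition5 (R : realType) (F : finFieldType) :
  let prob (n : nat) : R := (num_distinct_degree F n)%:R / #|F|%:R ^+ n in
  [/\ delta_partial R F @ \oo --> delta R F,
      (fun n : nat => prob n - delta R F) =O_\oo (fun n : nat => n%:R^-1 : R)
    & full_oscillating_expansion prob].
Proof.
move=> prob; set g := prob_diff R F; set h := irr_coef R F.
have probE n : prob n = psum g n.+1 := prob_psum R F n.
have [K hK] := bnd_irr_coef R F.
have [l [hl _]] := err_psum (bnd_err hK).
have dl := cvg_delta_partial hl.
have deltaE : delta R F = (1 + irr_density R F 1) * l by apply: cvg_lim dl.
have probl : prob @ \oo --> delta R F.
  have -> : prob = (fun n => psum h n.+1 + irr_density R F 1 * psum h n).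
    by apply/funext => n; rewrite probE prob_diffE.
  rewrite deltaE mulrDl mul1r; apply: cvgD; first by rewrite cvg_shiftS.
  by apply: cvgM hl; apply: cvg_cst.
split.
- by rewrite deltaE.
- have [C eC] := bnd_binomial_coef (irr_density R F 1) 1 2.
  have [D gD] : exists D, bnd D 2 g by eexists; exact: convol_bnd eC hK.
  have D0 := bnd_ge0 gD.
  apply/eqO_exP; exists (2 * D + 1); first by rewrite ltr_wpDl ?mulr_ge0.
  near=> n; have n0 : (0 < n)%N by near: n; exists 1%N.
  (* The Cauchy estimate is uniform in [m]; letting [m] tend to infinity turns it into a bound on
     the distance to the limit. *)
  have cvl : (fun m => `|prob m - prob n|) @ \oo --> `|delta R F - prob n|.
    by apply: cvg_norm; apply: cvgB; [exact: probl|exact: cvg_cst].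
  rewrite distrC; apply: (cvgr_to_le cvl).
  exists n => // m /= nm; rewrite !probE.
  apply: le_trans (bnd_psum_tail gD (nm : n.+1 <= m.+1)%N) _.
  rewrite ger0_norm ?invr_ge0 // ler_pM ?invr_ge0 ?mulr_ge0 ?lerDl //.
  by rewrite lef_pV2 ?posrE ?ltr0n // ler_nat; lia.
- apply: asy_full_expansion => s.
  have ag : asy s.+1 1 g.
    (* The factor [1 + a_1 z] plays the part of [e]: with finitely many coefficients, it has the
       decay [s + 3] that [fam_asy] asks for at order [s + 1]. *)
    have [C eC] := bnd_binomial_coef (irr_density R F 1) 1 s.+3.
    apply: (fam_asy (nder_irr_coef R F) (@periodic_osc_coef R) (bnd_weak (isT : 1 <= 2)%N hK)).
      exact: irr_ld_expansion.
    exact: fam_base eC.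
  (* Summation costs one order, and [prob n] also includes the last term [g n]. *)
  have ap := asy_psum (ltn0Sn 0) ag.
  apply: eq_asy (asyD ap (asy_weak (leqnSn s) (leq0n 1) ag)) => n.
  by rewrite probE /psum big_ord_recr.
Unshelve. all: by end_near. Qed.
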